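(* In the corrupted stochastic $K$-armed bandit described in the context, suppose $C_T\le K\,T^\beta$ for some $\beta\in(0,\tfrac12)$, and run the Regularized-EXP3 algorithm (fed with the observed corrupted losses) with mirror map $\phi_\alpha$, $\alpha\in[0,1]$, and parameters $\eta=1/\sqrt T$, $\varepsilon=\lambda=\frac1{\sqrt K}T^{-(\frac12-\beta)}$. Then the regret $\mathcal R(T)=\mathbb E\left[\sum_{t=1}^T\ell_{t,A_t}\right]-T\mu^\star$, with $\mu^\star=\min_j\mu_j$, satisfies $$\mathcal R(T)\le\begin{cases}\left(2\sqrt K\log T+2\log T\cdot T^\beta\right)\sqrt{KT}, &\alpha\in[0,\tfrac13),\\[2pt] \left(4\sqrt K\log K+2\log T\cdot T^\beta\right)\sqrt{KT}, &\alpha\in[\tfrac13,1].\end{cases}$$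
   Context: Corrupted stochastic $K$-armed bandit: at each round $t$ there is an underlying loss vector $\ell_t\in[0,1]^K$ whose coordinate $\ell_{t,a}$ is drawn from a distribution $\mathcal P_a$ on $[0,1]$ with mean $\mu_a$, independently across rounds. After $\ell_t$ is realized, an adversary produces $\ell^c_t\in[0,1]^K$; the learner picks $A_t$ and observes only $\ell^c_{t,A_t}$. Corruption level $C_T=\sum_{t=1}^T\mathbb E[\|\ell^c_t-\ell_t\|_\infty]$. $\Delta_\varepsilon=\{x\in\mathbb R^K: x_j\ge\varepsilon\ \forall j,\ \sum_jx_j=1\}$; $R_\varepsilon(x)=-\sum_i\ln x_i+\frac1\varepsilon\sum_ix_i$. Mirror maps on $\mathbb R^K_{>0}$: $\phi_\alpha(x)=-\sum_i\frac{x_i^\alpha-\alpha x_i-(1-\alpha)}{\alpha(1-\alpha)}$ for $0<\alpha<1$, $\phi_0(x)=-\sum_i(\log x_i-x_i+1)$, $\phi_1(x)=\sum_i(x_i\log x_i-x_i+1)$. $D_\phi(x,y)=\phi(x)-\phi(y)-\langle\nabla\phi(y),x-y\rangle$. Regularized-EXP3: $z_1=(1/K,\dots,1/K)$; for $t=1,\dots,T$: $x_t=\arg\min_{x\in\Delta_\varepsilon}D_\phi(x,z_t)$; draw $A_t$ with $\mathbb P(A_t=j\mid\text{past})=x_{t,j}$, observe $\ell^c_{t,A_t}$; $\widehat\ell_{t,j}=\mathbb I\{A_t=j\}\ell^c_{t,A_t}/x_{t,j}$; $\widetilde\ell_t=\widehat\ell_t+\lambda\nabla R_\varepsilon(x_t)$;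 $z_{t+1}=\arg\min_x\{\eta\langle\widetilde\ell_t,x\rangle+D_\phi(x,x_t)\}$. *)

(* Defs.v *)
From HB Require Import structures.
From mathcomp Require Import all_boot all_order all_algebra.
From mathcomp Require Import all_classical all_reals all_analysis.
Set Implicit Arguments. Unset Strict Implicit. Unset Printing Implicit Defensive.
Import Order.TTheory GRing.Theory Num.Theory.
Import numFieldNormedType.Exports.
Local Open Scope classical_set_scope.
Local Open Scope ring_scope.

Definition phi_alpha (R : realType) (K : nat) (a : R) (x : 'I_K -> R) : R :=
  if a == 0 then - \sum_(i < K) (ln (x i) - x i + 1)
  else if a == 1 then \sum_(i < K) (x i * ln (x i) - x i + 1)
  else - \sum_(i < K) ((x i `^ a - a * x i - (1 - a)) / (a * (1 - a))).

Definition pderiv (R : realType) (K : nat) (F : ('I_K -> R) -> R)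
  (y : 'I_K -> R) (i : 'I_K) : R :=
  derive1 (fun h : R => F (fun j => y j + (if j == i then h else 0))) 0.

Definition bregman (R : realType) (K : nat) (F : ('I_K -> R) -> R)
  (x y : 'I_K -> R) : R :=
  F x - F y - \sum_(i < K) pderiv F y i * (x i - y i).

Definition trunc_simplex (R : realType) (K : nat) (eps : R) : set ('I_K -> R) :=
  [set x | (forall j, eps <= x j) /\ \sum_(j < K) x j = 1].

Definition pos_orthant (R : realType) (K : nat) : set ('I_K -> R) :=
  [set x | forall j, 0 < x j].

Definition reg_eps (R : realType) (K : nat) (eps : R) (x : 'I_K -> R) : R :=
  - \sum_(i < K) ln (x i) + eps^-1 * \sum_(i < K) x i.

Definition dotv (R : realType) (K : nat) (u v : 'I_K -> R) : R :=
  \sum_(i < K) u i * v i.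

(* Main.v *)
Require Import Defs.
From HB Require Import structures.
From mathcomp Require Import all_boot all_order all_algebra.
From mathcomp Require Import all_classical all_reals all_analysis.
From mathcomp Require Import measurable_realfun ring lra.
Import Order.TTheory GRing.Theory Num.Theory.
Import numFieldNormedType.Exports.
Local Open Scope classical_set_scope.
Local Open Scope ring_scope.

(** Mirror descent on the truncated simplex, compared with the vertex of the best
arm smoothed into the simplex, has regret at most [D(u, z_1) / eta] plus a stability
term; since the estimated losses are nonnegative and the second derivative of
every [phi_alpha] is at least [1 / x] on ]0, 1], the latter is at most
[eta * \sum_i ltil_i ^ 2 * x_i], of conditional expectation at most
[eta * (K + 3)].  The regularizer and the smoothing of the vertex cost
[eps * K] per round each, the corruption at most [2 C_T].  Feasibility of the
truncated simplex means [K * eps <= 1], i.e. [K <= T ^ (1 - 2 beta)], so that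
[C_T <= \sqrt (K T)]; all terms then fit into the stated rate as soon as
[ln T >= 4], and for smaller [T] the rate exceeds the trivial bound [T].

Measurability of the iterates is derived from the algorithm: the projection is
a continuous function of the dual vector [dphi (z_t)], which the mirror step
expresses through the past. *)

(** * Scalar potentials: convexity and curvature *)

Section Potential.
Set Implicit Arguments. Unset Strict Implicit.
Context {R : realType}.
Implicit Types a s r p z : R.

Lemma ln_le_subr1 s : 0 < s -> ln s <= s - 1.
Proof.
move=> s0; have := @le_ln1Dx R (s - 1).
by rewrite addrCA subrr addr0; apply; rewrite ltrBrDl subrr.
Qed.

Lemma powR_ge_1Dln p s : 0 < s -> 1 + p * ln s <= s `^ p.
Proof. by move=> s0; rewrite /powR gt_eqF// expR_ge1Dx. Qed.

(** Weighted AM-GM for [s] and 1 with weights [p] and [1 - p], whose mean is [m]. Apply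
    [ln r <= r - 1] at [s / m] and [1 / m]: the weighted right-hand sides cancel. *)
Lemma powR_le_affine p s : 0 <= p <= 1 -> 0 < s -> s `^ p <= 1 + p * (s - 1).
Proof.
move=> /andP[p0 p1] s0; set m := 1 + p * (s - 1).
have m0 : 0 < m.
  rewrite /m; case: (ltrP p 1) => [?|?]; first by nra.
  have -> : p = 1 by lra.
  lra.
rewrite /powR gt_eqF// -[leRHS](lnK m0) ler_expR.
have h1 : ln (s / m) <= s / m - 1 by apply: ln_le_subr1; exact: divr_gt0.
have h2 : ln (1 / m) <= 1 / m - 1 by apply: ln_le_subr1; exact: divr_gt0.
rewrite ln_div ?posrE// in h1; rewrite ln_div ?posrE// ln1 in h2.
have : p * (s / m - 1) + (1 - p) * (1 / m - 1) = 0.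
  by rewrite /m; field; exact: lt0r_neq0.
nra.
Qed.

(** Up to affine terms: the log barrier at 0, negative Shannon entropy at 1, negative Tsallis
    entropy in between. In all cases the second derivative is [s ^ (a - 2)]. *)
Definition pot a s : R :=
  if a == 0 then - (ln s - s + 1)
  else if a == 1 then s * ln s - s + 1
  else - ((s `^ a - a * s - (1 - a)) / (a * (1 - a))).

Definition dpot a s : R :=
  if a == 0 then 1 - s^-1
  else if a == 1 then ln s
  else (1 - s `^ (a - 1)) / (1 - a).

Lemma phi_alphaE K a (x : 'I_K -> R) : phi_alpha a x = \sum_(i < K) pot a (x i).
Proof.
by rewrite /phi_alpha /pot; case: ifP => _; [|case: ifP => _ //]; rewrite -sumrN.
Qed.

Lemma is_derive_pot a s : 0 < s -> is_derive s 1 (pot a) (dpot a s).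
Proof.
move=> s0; rewrite /pot /dpot.
have dln := is_derive1_ln s0.
case: ifP => [_|a0].
  apply: is_derive_eq; ring.
case: ifP => [_|a1].
  apply: is_derive_eq; rewrite /GRing.scale/=.
  by field; exact: lt0r_neq0.
have dp := is_derive1_powR a s0.
apply: is_derive_eq; rewrite /GRing.scale/=.
field; apply/andP; split; last by rewrite a0.
by rewrite subr_eq0 eq_sym a1.
Qed.

Lemma alpha_open a : 0 <= a <= 1 -> (a == 0) = false -> (a == 1) = false ->
  0 < a < 1.
Proof. by move=> /andP[? ?] n0 n1; rewrite !lt_neqAle eq_sym n0 n1/=; apply/andP. Qed.

(** Convexity in tangent form, without second derivatives: the boundary cases reduce to
    [ln r <= r - 1] applied to a ratio, the intermediate ones to Bernoulli's inequality for
    [r / s]. *)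
Lemma pot_tangent a s r : 0 <= a <= 1 -> 0 < s -> 0 < r ->
  pot a s + dpot a s * (r - s) <= pot a r.
Proof.
move=> ha s0 r0; rewrite /pot /dpot.
have sr0 : 0 < r / s by exact: divr_gt0.
have rs0 : 0 < s / r by exact: divr_gt0.
case: ifP => [_|a0].
  have := ln_le_subr1 sr0; rewrite ln_div ?posrE//.
  have -> : (1 - s^-1) * (r - s) = r - s - r / s + 1.
    by field; exact: lt0r_neq0.
  lra.
case: ifP => [_|a1].
  have := ln_le_subr1 rs0; rewrite ln_div ?posrE// => h.
  have : r * (ln s - ln r) <= r * (s / r - 1) by rewrite ler_pM2l.
  have -> : r * (s / r - 1) = s - r by field; exact: lt0r_neq0.
  lra.
have /andP[a_gt0 a_lt1] := alpha_open ha a0 a1.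
have h : r `^ a <= s `^ a * (1 + a * (r / s - 1)).
  have -> : r `^ a = s `^ a * (r / s) `^ a.
    by rewrite -powRM ?ltW// mulrC divfK// lt0r_neq0.
  by rewrite ler_pM2l ?powR_gt0// powR_le_affine.
have e : s `^ a = s * s `^ (a - 1) by rewrite mulr_powRB1// ltW.
have {}h : r `^ a <= s `^ a + a * s `^ (a - 1) * (r - s).
  apply: le_trans h _; rewrite e le_eqVlt; apply/orP; left; apply/eqP.
  by field; exact: lt0r_neq0.
have d0 : 0 < (a * (1 - a))^-1 by rewrite invr_gt0 mulr_gt0// subr_gt0.
rewrite -subr_ge0.
have -> : - ((r `^ a - a * r - (1 - a)) / (a * (1 - a))) -
  (- ((s `^ a - a * s - (1 - a)) / (a * (1 - a))) +
   (1 - s `^ (a - 1)) / (1 - a) * (r - s)) =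
  (a * (1 - a))^-1 * (s `^ a + a * s `^ (a - 1) * (r - s) - r `^ a).
  by field; rewrite a0 subr_eq0 eq_sym a1.
by rewrite mulr_ge0 ?subr_ge0// ltW.
Qed.

(** The tangent inequality at [s] of the concave function [dpot a], whose slope there is
    [s ^ (a - 2)]. *)
Lemma dpot_concave a s z : 0 <= a <= 1 -> 0 < s -> 0 < z ->
  s `^ (a - 2) * (s - z) <= dpot a s - dpot a z.
Proof.
move=> ha s0 z0; rewrite /dpot.
have sn0 : s != 0 by exact: lt0r_neq0.
have zn0 : z != 0 by exact: lt0r_neq0.
have zs0 : 0 < z / s by exact: divr_gt0.
case: ifP => [/eqP ->|a0].
  rewrite sub0r powR_invn ?(ltW s0)// -subr_ge0.
  have -> : 1 - s^-1 - (1 - z^-1) - s ^- 2 * (s - z) = (s - z) ^+ 2 / (s ^+ 2 * z).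
    by field; rewrite ?sn0 ?zn0.
  by rewrite divr_ge0 ?sqr_ge0// mulr_ge0 ?sqr_ge0// ltW.
case: ifP => [/eqP ->|a1].
  have -> : (1 - 2 : R) = -1 by ring.
  rewrite powR_inv1 ?(ltW s0)//; have := ln_le_subr1 zs0.
  rewrite ln_div ?posrE//; have -> : s^-1 * (s - z) = 1 - z / s by field.
  lra.
have /andP[a_gt0 a_lt1] := alpha_open ha a0 a1.
have -> : s `^ (a - 2) = s `^ (a - 1) / s.
  by rewrite -[in RHS](powR_inv1 (ltW s0)) -powRD ?sn0 ?implybT//; congr (_ `^ _); ring.
have -> : z `^ (a - 1) = s `^ (a - 1) * (z / s) `^ (a - 1).
  by rewrite -powRM ?ltW// mulrC divfK.
have h : 1 + (1 - a) * (1 - z / s) <= (z / s) `^ (a - 1).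
  apply: le_trans (powR_ge_1Dln _ zs0).
  have : (1 - a) * ln (z / s) <= (1 - a) * (z / s - 1).
    by rewrite ler_pM2l ?subr_gt0// ln_le_subr1.
  lra.
have p0 : 0 < s `^ (a - 1) by exact: powR_gt0.
rewrite -subr_ge0; set w := (z / s) `^ _ in h *; set q := s `^ _ in p0 *.
have -> : (1 - q) / (1 - a) - (1 - q * w) / (1 - a) - q / s * (s - z) =
  q * (w - (1 + (1 - a) * (1 - z / s))) / (1 - a).
  by field; rewrite sn0 subr_eq0 eq_sym a1.
by rewrite divr_ge0 ?mulr_ge0 ?subr_ge0//; exact: ltW.
Qed.

Lemma dpot_le a s z : 0 <= a <= 1 -> 0 < s -> 0 < z ->
  dpot a z <= dpot a s -> z <= s.
Proof.
move=> ha s0 z0; apply: contraTT; rewrite -!ltNge => sz.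
have := @dpot_concave a z s ha z0 s0; rewrite -subr_gt0; apply: lt_le_trans.
by rewrite mulr_gt0 ?powR_gt0 ?subr_gt0.
Qed.

(** As [a - 2 <= -1] and [s <= 1], the slope [s ^ (a - 2)] is at least [s^-1]. This curvature bound
    is the same for all [a], and so is the stability term derived from it. *)
Lemma dpot_sub_ge a s z : 0 <= a <= 1 -> 0 < s <= 1 -> 0 < z <= s ->
  (s - z) / s <= dpot a s - dpot a z.
Proof.
move=> ha /andP[s0 s1] /andP[z0 zs].
apply: le_trans (dpot_concave ha s0 z0).
rewrite mulrC -[s^-1](powR_inv1 (ltW s0)) ler_wpM2r ?subr_ge0//.
by apply: ger_powR; [rewrite s0|case/andP: ha => _; rewrite lerBlDr; lra].
Qed.

Lemma dpot_strongly_monotone a s z : 0 <= a <= 1 -> 0 < s <= 1 -> 0 < z <= 1 ->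
  (s - z) ^+ 2 <= (dpot a s - dpot a z) * (s - z).
Proof.
move=> ha; wlog zs : s z / z <= s => [hw hs hz|hs hz].
  case: (lerP z s) => [/hw|/ltW /hw]; first exact.
  by move=> /(_ hz hs); nra.
have [s0 s1] := andP hs.
have : s - z <= (s - z) / s by rewrite ler_peMr ?subr_ge0// invf_ge1.
have := @dpot_sub_ge a s z ha hs; rewrite zs andbT => /(_ (proj1 (andP hz))).
nra.
Qed.

Lemma continuous_dpot a s : 0 < s -> {for s, continuous (dpot a)}.
Proof.
move=> s0.
have dln := is_derive1_ln s0.
have dp := is_derive1_powR (a - 1) s0.
suff : derivable (dpot a) s 1 by move/derivable1_diffP/differentiable_continuous.
rewrite /dpot; case: (a == 0) => /=.
  apply: derivableB => //.
  by apply: derivableV => //; exact: lt0r_neq0.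
by case: (a == 1); [exact: ex_derive|exact: ex_derive].
Qed.

(** Clipping at 0 lets the reciprocal be replaced by the power of exponent -1, which agrees with it
    on nonnegative reals. The clipping has no effect on the positive iterates. *)
Lemma measurable_dpot a : measurable_fun setT (fun s => dpot a (Num.max 0 s)).
Proof.
have m0 : measurable_fun setT (fun s : R => Num.max 0 s) by exact: measurable_maxr.
rewrite /dpot; case: (a == 0) => /=.
  apply: measurable_funB => //.
  apply: (eq_measurable_fun (fun s => (Num.max 0 s) `^ (-1))).
    by move=> s _ /=; rewrite powR_inv1// le_max lexx.
  exact: (measurableT_comp (measurable_powR (-1)) m0).
case: (a == 1); first exact: (measurableT_comp (@measurable_ln R) m0).
apply: measurable_funM => //; apply: measurable_funB => //.
exact: (measurableT_comp (measurable_powR (a - 1)) m0).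
Qed.

End Potential.

(** * Optimality conditions and one-step inequalities of mirror descent *)

Section MirrorStep.
Set Implicit Arguments. Unset Strict Implicit.
Context {R : realType} {K : nat}.
Implicit Types (a eps : R) (x y z u v l c : 'I_K -> R).

Lemma pderiv_separable (F : ('I_K -> R) -> R) (f : R -> R) y i (d : R) :
  (forall x, F x = \sum_(j < K) f (x j)) -> is_derive (y i) 1 f d ->
  pderiv F y i = d.
Proof.
move=> FE fd; rewrite /pderiv.
have -> : (fun h : R => F (fun j => y j + (if j == i then h else 0))) =
    (f \o shift (y i)) \+ cst (\sum_(j < K | j != i) f (y j)).
  apply/funext => h /=; rewrite FE (bigD1 i)//= eqxx addrC [in RHS]addrC [h + _]addrC.
  by congr (_ + _); apply: eq_bigr => j /negbTE ->; rewrite addr0.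
rewrite derive1E.
have fd' : is_derive (shift (y i) 0) 1 f d by rewrite /shift/= add0r.
have sd : is_derive (0 : R) 1 (shift (y i)) 1.
  by apply: is_derive_eq; rewrite addr0.
have h := is_derive1_comp fd' sd.
by rewrite derive_val/= mulr1 addr0.
Qed.

Lemma pderiv_phi a y i : 0 < y i -> pderiv (phi_alpha a) y i = dpot a (y i).
Proof.
by move=> y0; apply: pderiv_separable (phi_alphaE a) _; exact: is_derive_pot.
Qed.

Lemma pderiv_reg (eps : R) y i : 0 < y i ->
  pderiv (reg_eps eps) y i = eps^-1 - (y i)^-1.
Proof.
move=> y0; apply: (@pderiv_separable _ (fun s => - ln s + eps^-1 * s)).
  by move=> x; rewrite /reg_eps big_split/= sumrN mulr_sumr.
have dln := is_derive1_ln y0.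
by apply: is_derive_eq; rewrite /GRing.scale/=; ring.
Qed.

(** Explicit form of the divergence, equal to [bregman] as soon as the second argument is positive;
    afterwards divergences are handled by coordinatewise algebra. *)
Definition breg (a : R) x y : R :=
  \sum_(i < K) (pot a (x i) - pot a (y i) - dpot a (y i) * (x i - y i)).

Lemma bregman_phi a x y : (forall i, 0 < y i) ->
  bregman (phi_alpha a) x y = breg a x y.
Proof.
move=> y0; rewrite /bregman /breg !sumrB !phi_alphaE.
by congr (_ - _); apply: eq_bigr => i _; rewrite pderiv_phi.
Qed.

Lemma breg_ge0 a x y : 0 <= a <= 1 -> (forall i, 0 < x i) ->
  (forall i, 0 < y i) -> 0 <= breg a x y.
Proof.
move=> ha x0 y0; apply: sumr_ge0 => i _.
have := pot_tangent ha (y0 i) (x0 i); lra.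
Qed.

Lemma three_points a u x z :
  breg a u z = breg a u x + breg a x z +
    \sum_(i < K) (dpot a (x i) - dpot a (z i)) * (u i - x i).
Proof. by rewrite /breg -!big_split/=; apply: eq_bigr => i _; ring. Qed.

(* Comparing with the tangent at the nearby point [x + h v] instead of
   differentiating at [x] leaves only the continuity of [g] to be used. *)
Lemma first_order_optimality (f g : R -> R) c x v (e : R) :
  (forall s r, 0 < s -> 0 < r -> f s + g s * (r - s) <= f r) ->
  (forall s, 0 < s -> {for s, continuous g}) ->
  (forall i, 0 < x i) -> 0 < e ->
  (forall h, 0 < h < e -> (forall i, 0 < x i + h * v i) /\
     \sum_(i < K) (c i * x i + f (x i)) <=
     \sum_(i < K) (c i * (x i + h * v i) + f (x i + h * v i))) ->
  0 <= \sum_(i < K) (c i + g (x i)) * v i.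
Proof.
move=> tan cg x0 e0 hmin.
pose S h := \sum_(i < K) (c i + g (x i + h * v i)) * v i.
have S0 h : 0 < h < e -> 0 <= S h.
  move=> he; have [y0 le] := hmin h he; have [h0 _] := andP he.
  rewrite -(pmulr_rge0 _ h0) /S mulr_sumr.
  rewrite -subr_ge0 -sumrB in le; apply: le_trans le _.
  apply: ler_sum => i _.
  by have := tan _ _ (y0 i) (x0 i); lra.
have cS : S h @[h --> 0^'+] --> \sum_(i < K) (c i + g (x i)) * v i.
  apply: cvg_at_right_filter.
  rewrite /S.
  apply: cvg_big => //; first exact: add_continuous.
  move=> i _; apply: cvgM; last exact: cvg_cst.
  apply: cvgD; first exact: cvg_cst.
  have cx : (x i + h * v i) @[h --> (0 : R)] --> x i.
    rewrite -[X in _ --> X]addr0 -[X in _ --> _ + X](mul0r (v i)).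
    apply: cvgD; first exact: cvg_cst.
    by apply: cvgM; [exact: cvg_id|exact: cvg_cst].
  exact: (cvg_comp _ _ cx (cg _ (x0 i))).
rewrite -(cvg_lim _ cS)//; apply: limr_ge.
  by apply/cvg_ex; eexists; exact: cS.
near=> h; apply: S0; apply/andP; split => //.
Unshelve. all: by end_near.
Qed.

Lemma trunc_simplexP eps x i : 0 < eps -> trunc_simplex eps x -> 0 < x i <= 1.
Proof.
move=> e0 [xe x1]; have x0 j : 0 < x j by exact: lt_le_trans (xe j).
rewrite x0 -x1 (bigD1 i)//= lerDl; apply: sumr_ge0 => j _; exact: ltW.
Qed.

(** The segment from [x] to [u] stays in the truncated simplex by convexity, so the direction
    [u - x] is admissible for steps up to 1. *)
Lemma projection_optimality a eps x z u : 0 <= a <= 1 -> 0 < eps ->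
  (forall i, 0 < z i) -> trunc_simplex eps x ->
  (forall y, trunc_simplex eps y ->
     bregman (phi_alpha a) x z <= bregman (phi_alpha a) y z) ->
  trunc_simplex eps u ->
  0 <= \sum_(i < K) (dpot a (x i) - dpot a (z i)) * (u i - x i).
Proof.
move=> ha e0 z0 hx hmin hu.
have x0 i : 0 < x i by have /andP[] := trunc_simplexP i e0 hx.
under eq_bigr do rewrite addrC.
apply: (@first_order_optimality (pot a) (dpot a) (fun i => - dpot a (z i)) x
  (fun i => u i - x i) 1) => //.
- by move=> s r s0 r0; exact: pot_tangent.
- by move=> s s0; exact: continuous_dpot.
move=> h /andP[h0 h1].
have hy : trunc_simplex eps (fun i => x i + h * (u i - x i)).
  split=> [j|].
    by have := hx.1 j; have := hu.1 j; nra.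
  by rewrite big_split/= -mulr_sumr sumrB hx.2 hu.2 subrr mulr0 addr0.
split => [i|]; first by have /andP[] := trunc_simplexP i e0 hy.
have := hmin _ hy; rewrite !bregman_phi// /breg -subr_ge0 -sumrB => le.
rewrite -subr_ge0 -sumrB; apply: le_trans le _; apply: ler_sum => i _; lra.
Qed.

(** The minimizer lies in an open orthant, so both directions along the [i]-th axis are admissible
    for steps below [z i]; the two resulting inequalities force the partial derivative to vanish. *)
Lemma mirror_optimality a (eta : R) l x z i : 0 <= a <= 1 ->
  (forall i, 0 < x i) -> (forall i, 0 < z i) ->
  (forall y, pos_orthant y ->
    eta * dotv l z + bregman (phi_alpha a) z x <=
    eta * dotv l y + bregman (phi_alpha a) y x) ->
  dpot a (z i) = dpot a (x i) - eta * l i.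
Proof.
move=> ha x0 z0 hmin.
have key (b : R) : `|b| = 1 ->
    0 <= \sum_(j < K) ((eta * l j - dpot a (x j)) + dpot a (z j)) *
           (if j == i then b else 0).
  move=> b1; apply: (@first_order_optimality (pot a) (dpot a)
    (fun j => eta * l j - dpot a (x j)) z (fun j => if j == i then b else 0) (z i)) => //.
  - by move=> s r s0 r0; exact: pot_tangent.
  - by move=> s s0; exact: continuous_dpot.
  move=> h /andP[h0 hz].
  have hy j : 0 < z j + h * (if j == i then b else 0).
    case: eqP => [->|_]; last by rewrite mulr0 addr0.
    have : - 1 <= b by rewrite -b1 lerNl -normrN ler_norm.
    nra.
  split => //.
  have := hmin _ hy; rewrite !bregman_phi// /breg /dotv !mulr_sumr.
  rewrite -!big_split/= -subr_ge0 -sumrB => le.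
  rewrite -subr_ge0 -sumrB; apply: le_trans le _; apply: ler_sum => j _; lra.
have sumE (b : R) : \sum_(j < K) ((eta * l j - dpot a (x j)) + dpot a (z j)) *
           (if j == i then b else 0) = ((eta * l i - dpot a (x i)) + dpot a (z i)) * b.
  by rewrite (bigD1 i)//= eqxx big1 ?addr0// => j /negbTE ->; rewrite mulr0.
have := key 1 (normr1 _); have := key (-1) (normrN1 _); rewrite !sumE; lra.
Qed.

(** By the three-point identity it remains to bound [breg a x z]. Convexity bounds each of its terms
    by [(dpot a (x i) - dpot a (z i)) * (x i - z i)], that is [eta * l i * (x i - z i)]. Since
    [l i >= 0] gives [z i <= x i], the curvature bound yields [x i - z i <= eta * l i * x i]. *)
Lemma mirror_step a (eta : R) l x z u : 0 <= a <= 1 -> 0 <= eta ->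
  (forall i, 0 <= l i) -> (forall i, 0 < x i <= 1) -> (forall i, 0 < z i) ->
  (forall i, dpot a (z i) = dpot a (x i) - eta * l i) ->
  eta * \sum_(i < K) l i * (x i - u i) <=
  breg a u x - breg a u z + eta ^+ 2 * \sum_(i < K) l i ^+ 2 * x i.
Proof.
move=> ha eta0 l0 x01 z0 dz.
rewrite (three_points a u x z) !mulr_sumr -subr_ge0 /breg opprD opprD !addrA subrr sub0r.
rewrite -!sumrN -!big_split/=; apply: sumr_ge0 => i _.
have /andP[x0 x1] := x01 i.
have el0 : 0 <= eta * l i by rewrite mulr_ge0.
have zx : z i <= x i by apply: (dpot_le ha) => //; rewrite dz gerBl.
have := @dpot_sub_ge R a (x i) (z i) ha (x01 i); rewrite z0 zx => /(_ isT).
rewrite ler_pdivrMr// dz => h.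
have := pot_tangent ha x0 (z0 i).
nra.
Qed.

(** Generalized Pythagorean inequality: in the three-point identity both additional terms are
    nonnegative, the linear one by optimality of the projection. *)
Lemma projection_step a eps x z u : 0 <= a <= 1 -> 0 < eps ->
  (forall i, 0 < z i) -> trunc_simplex eps x ->
  (forall y, trunc_simplex eps y ->
     bregman (phi_alpha a) x z <= bregman (phi_alpha a) y z) ->
  trunc_simplex eps u -> breg a u x <= breg a u z.
Proof.
move=> ha e0 z0 hx hmin hu; rewrite (three_points a u x z) -addrA lerDl addr_ge0//.
  by apply: breg_ge0 => // i; have /andP[] := trunc_simplexP i e0 hx.
exact: projection_optimality hu.
Qed.

(* The projection is 1/2-Hölder in the dual coordinates [dpot a (z i)], because
   [dpot a] is strongly monotone on ]0, 1]. *)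
Lemma projection_continuous a eps x x' z z' j : 0 <= a <= 1 -> 0 < eps ->
  (forall i, 0 < z i) -> (forall i, 0 < z' i) ->
  trunc_simplex eps x -> trunc_simplex eps x' ->
  (forall y, trunc_simplex eps y ->
     bregman (phi_alpha a) x z <= bregman (phi_alpha a) y z) ->
  (forall y, trunc_simplex eps y ->
     bregman (phi_alpha a) x' z' <= bregman (phi_alpha a) y z') ->
  (x j - x' j) ^+ 2 <= \sum_(i < K) `|dpot a (z i) - dpot a (z' i)|.
Proof.
move=> ha e0 z0 z0' hx hx' hm hm'.
have := projection_optimality ha e0 z0 hx hm hx'.
have := projection_optimality ha e0 z0' hx' hm' hx => h1 h2.
have := addr_ge0 h1 h2; rewrite -big_split/= => h.
apply: (@le_trans _ _ (\sum_(i < K) (x i - x' i) ^+ 2)).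
  by rewrite (bigD1 j)//= lerDl; apply: sumr_ge0 => i _; exact: sqr_ge0.
rewrite -subr_ge0 -sumrB; apply: le_trans h _; apply: ler_sum => i _.
have hi := trunc_simplexP i e0 hx; have hi' := trunc_simplexP i e0 hx'.
have := @dpot_strongly_monotone R a _ _ ha hi hi'.
have : (dpot a (z i) - dpot a (z' i)) * (x i - x' i) <=
    `|dpot a (z i) - dpot a (z' i)|.
  apply: le_trans (ler_norm _) _; rewrite normrM ler_piMr//.
  by rewrite ler_norml; case/andP: hi hi' => ? ? /andP[? ?]; lra.
lra.
Qed.

End MirrorStep.

(** * Divergence from the uniform starting point *)

Section UniformStart.
Set Implicit Arguments. Unset Strict Implicit.
Context {R : realType}.
Implicit Types a y e B : R.

(** Factoring out [y ^ a <= 1] leaves [1 - (s / y) ^ a], which is at most [a * ln (y / s)] and hence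
    [a * ln (y / e)]. The term linear in [s - y] is kept because it cancels when summed over the
    simplex. *)
Lemma pot_sub_le_ln a y e s : 0 <= a < 1 -> 0 < e -> e <= s -> e <= y <= 1 ->
  pot a s - pot a y <= (1 - a)^-1 * ln (y / e) + (1 - a)^-1 * (s - y).
Proof.
move=> /andP[a0 a1] e0 es /andP[ey y1].
have s0 : 0 < s by exact: lt_le_trans es.
have y0 : 0 < y by exact: lt_le_trans ey.
have les : ln e <= ln s by rewrite ler_ln.
have ley : ln e <= ln y by rewrite ler_ln.
rewrite ln_div ?posrE// /pot; case: ifP => [/eqP ->|an0].
  by rewrite subr0 invr1; lra.
rewrite lt_eqF//.
have sy0 : 0 < s / y by exact: divr_gt0.
have a_gt0 : 0 < a by rewrite lt_neqAle eq_sym an0.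
have -> : s `^ a = y `^ a * (s / y) `^ a.
  by rewrite -powRM ?ltW// mulrC divfK// lt0r_neq0.
have := powR_ge_1Dln a sy0; rewrite ln_div ?posrE//.
set w := (s / y) `^ a => hw.
have q0 : 0 < y `^ a by exact: powR_gt0.
have q1 : y `^ a <= 1.
  by rewrite -(powRr0 y); apply: ger_powR; rewrite ?y0.
set q := y `^ a in q0 q1 *.
have h : q * (1 - w) <= a * (ln y - ln e).
  have h1 : q * (1 - w) <= q * (a * (ln y - ln s)) by rewrite ler_pM2l//; lra.
  have h2 : q * (a * (ln y - ln s)) <= q * (a * (ln y - ln e)).
    by rewrite ler_pM2l// ler_pM2l//; lra.
  have h3 : q * (a * (ln y - ln e)) <= a * (ln y - ln e).
    by rewrite ler_piMl// mulr_ge0// subr_ge0.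
  exact: le_trans h1 (le_trans h2 h3).
have c0 : 0 <= (a * (1 - a))^-1 by rewrite invr_ge0 mulr_ge0// subr_ge0 ltW.
rewrite -subr_ge0.
have -> : (1 - a)^-1 * (ln y - ln e) + (1 - a)^-1 * (s - y) -
  (- ((q * w - a * s - (1 - a)) / (a * (1 - a))) -
   - ((q - a * y - (1 - a)) / (a * (1 - a)))) =
  (a * (1 - a))^-1 * (a * (ln y - ln e) - q * (1 - w)).
  by field; rewrite an0 subr_eq0 gt_eqF.
by rewrite mulr_ge0// subr_ge0.
Qed.

(** Here [s] may be arbitrarily small: [s <= s ^ a] replaces a lower bound on it, and
    [y ^ a - y = y ^ a * (1 - y ^ (1 - a))] is at most [- (1 - a) * ln y]. The factor 3 bounds
    [a^-1]. *)
Lemma pot_sub_le_entropy a y s : 3^-1 <= a <= 1 -> 0 < s <= 1 -> 0 < y <= 1 ->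
  pot a s - pot a y <= - 3 * ln y - a^-1 * (s - y).
Proof.
move=> /andP[a3 a1] /andP[s0 s1] /andP[y0 y1].
have a0 : 0 < a by apply: lt_le_trans a3; rewrite invr_gt0.
have lny : ln y <= 0 by exact: ln_le0.
rewrite /pot gt_eqF//; case: ifP => [/eqP ->|an1].
  have : ln s <= 0 by exact: ln_le0.
  by rewrite invr1; nra.
have a_lt1 : a < 1 by rewrite lt_neqAle an1.
have hs : s <= s `^ a by rewrite ger1_powR// s0.
have := powR_ge_1Dln (1 - a) y0; set w := y `^ (1 - a) => hw.
have q0 : 0 < y `^ a by exact: powR_gt0.
have q1 : y `^ a <= 1.
  by rewrite -(powRr0 y); apply: ger_powR; [rewrite y0|exact: ltW].
have yE : y = y `^ a * w.
  by rewrite -powRD ?(gt_eqF y0) ?implybT// addrCA subrr addr0 powRr1// ltW.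
set q := y `^ a in q0 q1 yE *.
have h : q - y <= - (1 - a) * ln y.
  have h1 : q * (1 - w) <= q * (- (1 - a) * ln y) by rewrite ler_pM2l//; lra.
  have h3 : q * (- (1 - a) * ln y) <= - (1 - a) * ln y.
    by rewrite ler_piMl//; nra.
  rewrite [X in q - X]yE; lra.
have c0 : 0 <= (a * (1 - a))^-1 by rewrite invr_ge0 mulr_ge0 ?subr_ge0 ?ltW.
have ha : - 3 * ln y >= - a^-1 * ln y.
  rewrite !mulNr lerN2 ler_wnM2r//.
  by rewrite -[3]invrK lef_pV2 ?posrE ?invr_gt0.
rewrite -subr_ge0.
have -> : - 3 * ln y - a^-1 * (s - y) -
  (- ((s `^ a - a * s - (1 - a)) / (a * (1 - a))) -
   - ((q - a * y - (1 - a)) / (a * (1 - a)))) =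
  (- 3 * ln y - - a^-1 * ln y) +
  (a * (1 - a))^-1 * ((s `^ a - s) + (- (1 - a) * ln y - (q - y))).
  by field; rewrite (gt_eqF a0) subr_eq0 eq_sym an1.
apply: addr_ge0; first by rewrite subr_ge0.
by apply: mulr_ge0 => //; apply: addr_ge0; rewrite subr_ge0.
Qed.

(** At the uniform point the gradient is a constant vector, orthogonal to differences of simplex
    points; for the same reason the linear term in the hypothesis costs nothing. *)
Lemma breg_uniform_le (K : nat) a eps e B (u : 'I_K -> R) : (0 < K)%N ->
  trunc_simplex eps u ->
  (forall i, pot a (u i) - pot a K%:R^-1 <= B + e * (u i - K%:R^-1)) ->
  breg a u (fun=> K%:R^-1) <= K%:R * B.
Proof.
move=> K0 [_ u1] h.
have s0 : \sum_(i < K) (u i - K%:R^-1) = 0.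
  by rewrite sumrB u1 sumr_const card_ord -(mulr_natl K%:R^-1) mulfV ?subrr// pnatr_eq0 -lt0n.
rewrite /breg sumrB -mulr_sumr s0 mulr0 subr0.
apply: le_trans (ler_sum _ (fun i _ => h i)) _.
by rewrite big_split/= -mulr_sumr s0 mulr0 addr0 sumr_const card_ord mulr_natl.
Qed.

End UniformStart.

(** * Measurability of a continuous function of measurable coordinates *)

Section ContinuousMeasurable.
Set Implicit Arguments. Unset Strict Implicit.

(** The hypothesis is upper semicontinuity for the topology pulled back along [theta]. A strict
    sublevel set is then open there, hence a countable union of boxes with rational centres and
    radii [1 / (n + 1)]. *)
Lemma measurable_fun_of_continuous_coords (R : realType) (d : measure_display)
    (T : measurableType d) (K : nat) (theta : 'I_K -> T -> R) (X : T -> R) :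
  (forall i, measurable_fun setT (theta i)) ->
  (forall w (e : R), 0 < e -> exists2 r : R, 0 < r & forall w',
     (forall i, `|theta i w - theta i w'| < r) -> X w' < X w + e) ->
  measurable_fun setT X.
Proof.
move=> mt hX mD; apply: (measurability _ (RGenInftyO.measurableE R)) => //.
move=> _ [_ [c ->] <-]; rewrite setTI.
pose box (p : {ffun 'I_K -> rat} * nat) : set T :=
  [set w | forall i, `|theta i w - ratr (p.1 i)| < p.2.+1%:R^-1].
(* Boxes leaving the sublevel set are replaced by the empty set, so that the union runs over the
   whole countable index type. *)
pose U p : set T := if `[< box p `<=` X @^-1` `]-oo, c[ >] then box p else set0.
have -> : X @^-1` `]-oo, c[ = \bigcup_p U p.
  rewrite eqEsubset; split => w; last first.
    by move=> [p _]; rewrite /U; case: ifPn => // /asboolP; apply.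
  rewrite /= in_itv/= => Xc.
  have [r r0 hr] := hX w (c - X w) (ltac:(by rewrite subr_gt0)).
  (* Half of [r], because two points of a box are compared through its centre. *)
  have [n hn] : exists n : nat, n.+1%:R^-1 < r / 2.
    have r20 : 0 < r / 2 by rewrite divr_gt0.
    exists (Num.bound (r / 2)^-1).
    rewrite -[ltRHS]invrK ltf_pV2 ?posrE ?invr_gt0 ?ltr0n//.
    apply: lt_trans (archi_boundP _) _; first by rewrite invr_ge0 ltW.
    by rewrite ltr_nat.
  have hq i : exists q : rat, `|theta i w - ratr q| < n.+1%:R^-1.
    have n0 : (0 : R) < n.+1%:R^-1 by rewrite invr_gt0.
    set c' := n.+1%:R^-1 in n0 *.
    have lt : theta i w - c' < theta i w + c' by lra.
    have [q] := rat_in_itvoo lt.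
    by rewrite in_itv/= => /andP[? ?]; exists q; rewrite ltr_norml; lra.
  exists ([ffun i => sval (cid (hq i))], n) => //.
  have bw : box ([ffun i => sval (cid (hq i))], n) w.
    by move=> i /=; rewrite ffunE; exact: svalP (cid (hq i)).
  rewrite /U; case: ifPn => // /asboolP; case => w' bw' /=.
  rewrite in_itv/=.
  suff : X w' < X w + (c - X w) by rewrite addrCA subrr addr0.
  apply: hr => i.
  have h1 := bw i; have h2 := bw' i.
  move: h1 h2 hn => /=; move: (ratr _) => q; move: (n.+1%:R^-1) => c' h1 h2 hn.
  have -> : theta i w - theta i w' = (theta i w - q) - (theta i w' - q) by ring.
  by apply: le_lt_trans (ler_normB _ _) _; lra.
apply: countable_bigcupT_measurable; first exact: countableP.
move=> p; rewrite /U; case: ifPn => // _.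
have -> : box p = \bigcap_(i in [set: 'I_K])
    (fun w => `|theta i w - ratr (p.1 i)|) @^-1` `]-oo, p.2.+1%:R^-1[.
  apply/seteqP; split => w /= h i; last by have := h i I; rewrite /= in_itv.
  by move=> _; rewrite /= in_itv/=; exact: h.
apply: fin_bigcap_measurable => // i _.
rewrite -[X in measurable X]setTI.
have m : measurable_fun setT (fun w => `|theta i w - ratr (p.1 i)|).
  by apply: measurableT_comp => //; exact: measurable_funB.
by apply: m => //; exact: measurable_itv.
Qed.

End ContinuousMeasurable.

(** * Expectations of bounded measurable functions *)

Section BoundedExpectation.
Set Implicit Arguments. Unset Strict Implicit.
Context {R : realType} {d : measure_display} {T : measurableType d}.
Variable P : probability T R.
Implicit Types f g : T -> R.

Definition bounded_measurable f :=
  measurable_fun setT f /\ exists M : R, forall w, `|f w| <= M.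

Definition Ex f : R := \int[P]_w f w.

Lemma bounded_measurable_integrable f :
  bounded_measurable f -> P.-integrable setT (EFin \o f).
Proof.
move=> [mf [M hM]]; apply: measurable_bounded_integrable => //.
  by apply: le_lt_trans (probability_le1 P _) _ => //; exact: ltry.
exists M; split; first exact: num_real.
by move=> x Mx w _; exact: le_trans (hM w) (ltW Mx).
Qed.

Lemma EFin_Ex f : bounded_measurable f -> (\int[P]_w (f w)%:E)%E = (Ex f)%:E.
Proof.
move=> /bounded_measurable_integrable fi; rewrite /Ex /Rintegral fineK//.
exact: integrable_fin_num.
Qed.

Lemma bounded_measurable_cst (c : R) : bounded_measurable (fun=> c).
Proof. by split => //; exists `|c|. Qed.

Lemma bounded_measurableD f g : bounded_measurable f -> bounded_measurable g ->
  bounded_measurable (fun w => f w + g w).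
Proof.
move=> [mf [M hM]] [mg [N hN]]; split; first exact: measurable_funD.
by exists (M + N) => w; apply: le_trans (ler_normD _ _) _; exact: lerD.
Qed.

Lemma bounded_measurableM f g : bounded_measurable f -> bounded_measurable g ->
  bounded_measurable (fun w => f w * g w).
Proof.
move=> [mf [M hM]] [mg [N hN]]; split; first exact: measurable_funM.
by exists (M * N) => w; rewrite normrM; exact: ler_pM.
Qed.

Lemma bounded_measurableB f g : bounded_measurable f -> bounded_measurable g ->
  bounded_measurable (fun w => f w - g w).
Proof.
move=> hf hg; have -> : (fun w => f w - g w) = (fun w => f w + -1 * g w).
  by apply/funext => w; rewrite mulN1r.
apply: bounded_measurableD => //; apply: bounded_measurableM => //.
exact: bounded_measurable_cst.
Qed.

Lemma bounded_measurable_sum (n : nat) (h : 'I_n -> T -> R) :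
  (forall i, bounded_measurable (h i)) ->
  bounded_measurable (fun w => \sum_(i < n) h i w).
Proof.
elim: n h => [|n IH] h hh.
  by under eq_fun do rewrite big_ord0; exact: bounded_measurable_cst.
under eq_fun do rewrite big_ord_recr/=.
by apply: bounded_measurableD => //; exact: IH.
Qed.

Lemma bounded_measurable01 f : measurable_fun setT f ->
  (forall w, 0 <= f w <= 1) -> bounded_measurable f.
Proof. by move=> mf h; split=> //; exists 1 => w; have := h w; rewrite ler_norml; lra. Qed.

Lemma Ex_cst (c : R) : Ex (fun=> c) = c.
Proof.
rewrite /Ex Rintegral_cst//.
by have -> : fine (P [set: T]) = 1 by [rewrite probability_setT]; rewrite mulr1.
Qed.

Lemma ExD f g : bounded_measurable f -> bounded_measurable g ->
  Ex (fun w => f w + g w) = Ex f + Ex g.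
Proof.
by move=> hf hg; rewrite /Ex RintegralD//; exact: bounded_measurable_integrable.
Qed.

Lemma ExB f g : bounded_measurable f -> bounded_measurable g ->
  Ex (fun w => f w - g w) = Ex f - Ex g.
Proof.
by move=> hf hg; rewrite /Ex RintegralB//; exact: bounded_measurable_integrable.
Qed.

Lemma ExZ (c : R) f : bounded_measurable f -> Ex (fun w => c * f w) = c * Ex f.
Proof.
by move=> hf; rewrite /Ex RintegralZl//; exact: bounded_measurable_integrable.
Qed.

Lemma Ex_sum (n : nat) (h : 'I_n -> T -> R) :
  (forall i, bounded_measurable (h i)) ->
  Ex (fun w => \sum_(i < n) h i w) = \sum_(i < n) Ex (h i).
Proof.
elim: n h => [|n IH] h hh.
  by rewrite big_ord0; under eq_fun do rewrite big_ord0; exact: Ex_cst.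
rewrite big_ord_recr/=; under eq_fun do rewrite big_ord_recr/=.
by rewrite ExD ?IH//; exact: bounded_measurable_sum.
Qed.

Lemma Ex_le f g : bounded_measurable f -> bounded_measurable g ->
  (forall w, f w <= g w) -> Ex f <= Ex g.
Proof.
by move=> hf hg h; apply: le_Rintegral => //; exact: bounded_measurable_integrable.
Qed.

Lemma Ex_pushforward (Q : probability R R) f : bounded_measurable f ->
  (forall B, measurable B -> P (f @^-1` B) = Q B) ->
  (\int[Q]_r r%:E)%E = (Ex f)%:E.
Proof.
move=> hf law; have [mf _] := hf; rewrite -EFin_Ex//.
rewrite (@eq_measure_integral _ _ _ _ (pushforward P f)); last first.
  by move=> B mB _; exact/esym/law.
by rewrite integral_pushforward//; exact: bounded_measurable_integrable.
Qed.

Lemma bounded_measurable_indic E : measurable E -> bounded_measurable (\1_E).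
Proof.
move=> mE; apply: bounded_measurable01; first exact: measurable_indic.
by move=> w; rewrite indicE; case: (_ \in _) => /=; lra.
Qed.

(** * Conditioning on a sub-sigma-algebra *)

Section SubSigmaAlgebra.
Variable H : set_system T.
Hypotheses (sH : sigma_algebra setT H) (Hm : H `<=` measurable).

(** Encoded by changing the measurable structure of the domain, so that the usual closure properties
    of measurable functions apply directly. *)
Definition sub_measurable f :=
  measurable_fun (setT : set (g_sigma_algebraType H)) (f : g_sigma_algebraType H -> R).

Lemma sub_measurableP f :
  sub_measurable f <-> (forall B, measurable B -> H (f @^-1` B)).
Proof.
split=> [mf B mB|h].
  by have := mf measurableT B mB; rewrite setTI measurable_g_measurableTypeE.
by move=> _ B mB; rewrite setTI measurable_g_measurableTypeE//; exact: h.
Qed.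

Lemma sub_measurable_measurable f : sub_measurable f -> measurable_fun setT f.
Proof. by move=> /sub_measurableP h _ B mB; rewrite setTI; apply: Hm; exact: h. Qed.

Lemma sub_measurable_indic E : H E -> sub_measurable (\1_E).
Proof.
by move=> HE; apply: measurable_indic; rewrite measurable_g_measurableTypeE.
Qed.

(* Peeling off binary digits: for [0 <= Y <= 1], [2 Y - 1{Y >= 1/2}] is again a
   [H]-measurable function with values in [0, 1], so each digit halves the bound
   on [|Ex (Y D)|]. *)
Lemma Ex_sub_measurable_eq0 (D : T -> R) f :
  bounded_measurable D -> (forall w, `|D w| <= 1) ->
  (forall E, H E -> Ex (fun w => \1_E w * D w) = 0) ->
  sub_measurable f -> bounded_measurable f -> Ex (fun w => f w * D w) = 0.
Proof.
move=> bD D1 h0 mf bf.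
have dyadic n : forall Y, sub_measurable Y -> (forall w, 0 <= Y w <= 1) ->
    `|Ex (fun w => Y w * D w)| <= 2^-1 ^+ n.
  elim: n => [|n IH] Y mY Y01.
    have bY : bounded_measurable Y.
      by apply: bounded_measurable01 => //; exact: sub_measurable_measurable.
    have bYD := bounded_measurableM bY bD.
    have hYD w : `|Y w * D w| <= 1.
      have /andP[Y0 Y1] := Y01 w.
      by rewrite normrM -[leRHS]mulr1 ler_pM// ger0_norm.
    rewrite expr0 ler_norml -[X in _ <= _ <= X]Ex_cst -[X in X <= _](Ex_cst (-1)).
    apply/andP; split; apply: Ex_le => //; try exact: bounded_measurable_cst.
      by move=> w; have := hYD w; rewrite ler_norml => /andP[].
    by move=> w; have := hYD w; rewrite ler_norml => /andP[].
  have bY : bounded_measurable Y.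
    by apply: bounded_measurable01 => //; exact: sub_measurable_measurable.
  pose E := Y @^-1` `[2^-1, +oo[.
  have HE : H E by move/sub_measurableP : mY; apply; exact: measurable_itv.
  pose Y' w := 2 * Y w - \1_E w.
  have mY' : sub_measurable Y'.
    apply: measurable_funB; last exact: sub_measurable_indic.
    exact: measurable_funM.
  have Y'01 w : 0 <= Y' w <= 1.
    rewrite /Y' indicE; have := Y01 w.
    have [|] := boolP (w \in E) => /=.
      by rewrite inE /E/= in_itv/= andbT => ? ?; lra.
    by rewrite notin_setE /E/= in_itv/= andbT => /negP; rewrite -ltNge => ? ?; lra.
  have bY' : bounded_measurable Y'.
    by apply: bounded_measurable01 => //; exact: sub_measurable_measurable.
  have -> : (fun w => Y w * D w) =
      (fun w => 2^-1 * (\1_E w * D w) + 2^-1 * (Y' w * D w)).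
    by apply/funext => w; rewrite /Y'; lra.
  have bED : bounded_measurable (fun w => \1_E w * D w).
    apply: bounded_measurableM => //.
    by apply: bounded_measurable_indic; exact: Hm.
  have bYD' := bounded_measurableM bY' bD.
  rewrite ExD; try by apply: bounded_measurableM => //; exact: bounded_measurable_cst.
  rewrite !ExZ// h0// mulr0 add0r normrM exprS.
  by rewrite ger0_norm ?ler_pM2l//; exact: IH.
have eq01 Y : sub_measurable Y -> (forall w, 0 <= Y w <= 1) ->
    Ex (fun w => Y w * D w) = 0.
  move=> mY Y01; apply/eqP; rewrite -normr_le0; apply/ler_addgt0Pr => e e0.
  rewrite add0r.
  have [n hn] : exists n : nat, 2^-1 ^+ n <= e.
    have : (fun n => 2^-1 ^+ n : R) @ \oo --> (0 : R).
      by apply: cvg_expr; rewrite ger0_norm//; lra.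
    move=> /cvgrPdist_le /(_ e e0) [n _ hn]; exists n.
    have := hn n (leqnn n); rewrite /= sub0r normrN ger0_norm// exprn_ge0//.
  exact: le_trans (dyadic n Y mY Y01) hn.
have [M hM] := bf.2.
pose N := `|M| + 1.
have N0 : 0 < N by rewrite /N ltr_pwDr.
have hN w : `|f w| <= N.
  by apply: le_trans (hM w) _; rewrite /N; have := ler_norm M; lra.
(* An affine change maps [[-N, N]] onto [[0, 1]]; the constant it introduces is handled by the event
   [setT]. *)
pose Y w := (f w + N) * (2 * N)^-1.
have mY : sub_measurable Y by apply: measurable_funM => //; exact: measurable_funD.
have Y01 w : 0 <= Y w <= 1.
  have := hN w; rewrite ler_norml /Y => /andP[h1 h2].
  apply/andP; split; first by rewrite divr_ge0//; lra.
  by rewrite ler_pdivrMr; lra.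
have bY : bounded_measurable Y.
  by apply: bounded_measurable01 => //; exact: sub_measurable_measurable.
have HT : H setT.
  by case: sH => H0 Hc _; have := Hc _ H0; rewrite setD0.
have -> : (fun w => f w * D w) = (fun w => 2 * N * (Y w * D w) + - N * (\1_[set: T] w * D w)).
  apply/funext => w; rewrite /Y indicT/=; field; exact: lt0r_neq0.
have bTD : bounded_measurable (fun w => \1_[set: T] w * D w).
  by apply: bounded_measurableM => //; exact: bounded_measurable_indic.
have bYD := bounded_measurableM bY bD.
rewrite ExD; try by apply: bounded_measurableM => //; exact: bounded_measurable_cst.
by rewrite !ExZ// h0// eq01// !mulr0 addr0.
Qed.

(** Here [p] is a version of the conditional probability of [S] given [H]. The difference [\1_S - p]
    integrates to 0 on every event of [H], hence against every bounded [H]-measurable function. *)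
Lemma Ex_conditional (S : set T) (p f : T -> R) : measurable S ->
  bounded_measurable p -> (forall w, 0 <= p w <= 1) ->
  (forall E, H E -> P (E `&` S) = (\int[P]_(w in E) (p w)%:E)%E) ->
  sub_measurable f -> bounded_measurable f ->
  Ex (fun w => \1_S w * f w) = Ex (fun w => p w * f w).
Proof.
move=> mS bp p01 cond mf bf.
have bS : bounded_measurable (\1_S : T -> R) by exact: bounded_measurable_indic.
have bD : bounded_measurable (fun w => \1_S w - p w) by exact: bounded_measurableB.
apply/eqP; rewrite -subr_eq0 -ExB; try exact: bounded_measurableM.
have -> : (fun w => \1_S w * f w - p w * f w) = (fun w => f w * (\1_S w - p w)).
  by apply/funext => w; ring.
apply/eqP; apply: Ex_sub_measurable_eq0 => //.
  move=> w; have := p01 w; rewrite indicE ler_norml; case: (_ \in _) => /= ?; lra.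
move=> E HE; have mE : measurable E by exact: Hm.
have bE : bounded_measurable (\1_E : T -> R) by exact: bounded_measurable_indic.
have -> : (fun w => \1_E w * (\1_S w - p w)) = (fun w => \1_(E `&` S) w - \1_E w * p w).
  by apply/funext => w; rewrite indicI/=; ring.
rewrite ExB; [|by apply: bounded_measurable_indic; exact: measurableI|exact: bounded_measurableM].
apply/eqP; rewrite subr_eq0; apply/eqP; apply: EFin_inj.
rewrite -!EFin_Ex; [|exact: bounded_measurableM|by apply: bounded_measurable_indic; exact: measurableI].
transitivity (\int[P]_(w in E) (p w)%:E)%E.
  by rewrite integral_indic//; [rewrite setIT; exact: cond|exact: measurableI].
rewrite integral_mkcond; apply: eq_integral => w _.
by rewrite patchE indicE; case: (_ \in _); rewrite ?mul1r ?mul0r.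
Qed.

End SubSigmaAlgebra.
End BoundedExpectation.

(** * Numerical estimates for the final rate *)

Section Numerics.
Set Implicit Arguments. Unset Strict Implicit.
Context {R : realType}.

Lemma expR1_le3 : expR 1 <= 3 :> R.
Proof.
have h : expR (- 6^-1) >= (5 / 6 : R).
  by have := @expR_ge1Dx R (- 6^-1); lra.
(* Six factors are enough: [(6 / 5) ^ 6] is still below 3. *)
have h6 : (5 / 6 : R) ^+ 6 <= expR (- 1).
  have -> : (- 1 : R) = (- 6^-1) * 6%:R by field.
  by rewrite expRM_natr lerXn2r ?nnegrE ?expR_ge0//; lra.
have e0 := @expR_gt0 R 1.
rewrite expRN in h6.
have : (3^-1 : R) <= (expR 1)^-1 by apply: le_trans h6; lra.
by rewrite lef_pV2 ?posrE.
Qed.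

Lemma ln_nat_ge1 (n : nat) : (2 < n)%N -> 1 <= ln n%:R :> R.
Proof.
move=> n2; rewrite -[leLHS]expRK ler_ln ?posrE ?expR_gt0 ?ltr0n//; last exact: leq_trans _ n2.
by apply: le_trans expR1_le3 _; rewrite ler_nat.
Qed.

Lemma ln_nat_ge_half (n : nat) : (1 < n)%N -> 2^-1 <= ln n%:R :> R.
Proof.
move=> n1; have n0 : (0 : R) < n%:R by rewrite ltr0n (leq_trans _ n1).
have := @ln_le_subr1 R n%:R^-1; rewrite invr_gt0 => /(_ n0).
rewrite lnV ?posrE//.
have : (n%:R^-1 : R) <= 2^-1 by rewrite lef_pV2 ?posrE// ler_nat.
lra.
Qed.

Lemma sqrt_le_of_ln (t : R) (n : nat) : 0 < t -> ln t <= 2 * n%:R ->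
  Num.sqrt t <= 3 ^+ n.
Proof.
move=> t0 h; rewrite -[leRHS]ger0_norm ?exprn_ge0// -sqrtr_sqr.
apply: ler_wsqrtr; rewrite -exprM -[leLHS](lnK t0).
apply: (@le_trans _ _ (expR (2 * n%:R))); first by rewrite ler_expR.
rewrite -natrM mulnC -[_%:R]mul1r expRM_natr.
by rewrite lerXn2r ?nnegrE ?expR_ge0// expR1_le3.
Qed.

Lemma truncation_levelE (K T : nat) (beta : R) : (0 < K)%N -> (0 < T)%N ->
  (Num.sqrt (K%:R))^-1 * T%:R `^ (- (2^-1 - beta)) =
  T%:R `^ beta / (Num.sqrt K%:R * Num.sqrt T%:R).
Proof.
move=> K0 T0; have t0 : (0 : R) < T%:R by rewrite ltr0n.
have -> : - (2^-1 - beta) = beta - 2^-1 by ring.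
rewrite powRB ?(gt_eqF t0) ?implybT// powR12_sqrt ?ltW//.
by rewrite invfM mulrCA mulrA.
Qed.

Lemma rate_bound (K T : nat) (beta alpha eps C D : R) :
  (1 < K)%N -> 0 < beta -> 4 <= ln T%:R :> R -> (0 < T)%N ->
  eps = T%:R `^ beta / (Num.sqrt K%:R * Num.sqrt T%:R) ->
  K%:R * eps <= 1 ->
  C <= K%:R * T%:R `^ beta ->
  D <= (if alpha < 3^-1 then K%:R * ln T%:R else 3 * K%:R * ln K%:R) ->
  2 * C + Num.sqrt T%:R * D + Num.sqrt T%:R * (K%:R + 3) + 2 * (eps * K%:R * T%:R)
  <= if alpha < 3^-1 then
      (2 * Num.sqrt K%:R * ln T%:R + 2 * ln T%:R * T%:R `^ beta)
        * Num.sqrt (K%:R * T%:R)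
    else
      (4 * Num.sqrt K%:R * ln K%:R + 2 * ln T%:R * T%:R `^ beta)
        * Num.sqrt (K%:R * T%:R).
Proof.
move=> K1 b0 L4 T0 epsE Keps hC hD.
have K0 : (0 < K)%N by exact: ltnW.
have lnK1 : (2 < K)%N -> 1 <= ln K%:R :> R by exact: ln_nat_ge1.
have lnKh : 2^-1 <= ln K%:R :> R by exact: ln_nat_ge_half.
have K2 : 2 <= K%:R :> R by rewrite ler_nat.
have K3 : (2 < K)%N -> 3 <= K%:R :> R by rewrite ler_nat.
(* For [K >= 3], [ln K >= 1] makes the spare [K * ln K] absorb [K]. Only [ln 2 >= 1 / 2] is at hand
   for [K = 2], which is therefore computed separately. *)
have KE : (2 < K)%N \/ K%:R = 2 :> R.
  by move: K1; rewrite leq_eqVlt => /orP[/eqP <-|]; [right|left].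
rewrite sqrtrM ?ler0n//.
have bge1 : 1 <= T%:R `^ beta :> R.
  by rewrite -[leLHS](powRr0 T%:R); apply: ler_powR; [rewrite ler1n|exact: ltW].
have kE : Num.sqrt K%:R ^+ 2 = K%:R :> R by rewrite sqr_sqrtr ?ler0n.
have sE : Num.sqrt T%:R ^+ 2 = T%:R :> R by rewrite sqr_sqrtr ?ler0n.
have k0 : 0 < Num.sqrt K%:R :> R by rewrite sqrtr_gt0 ltr0n.
have s0 : 0 < Num.sqrt T%:R :> R by rewrite sqrtr_gt0 ltr0n.
move: (Num.sqrt K%:R) (Num.sqrt T%:R) (T%:R `^ beta) kE sE k0 s0 bge1 epsE hC
  => k s b kE sE k0 s0 bge1 epsE hC.
(* A rational lower bound for the square root of 2. *)
have k1 : 7 / 5 <= k by rewrite -(ler_pXn2r (ltn0Sn 1)) ?nnegrE ?ltW//; lra.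
have eKT : eps * K%:R * T%:R = s * (k * b).
  by rewrite epsE -kE -sE; field; rewrite ?gt_eqF.
have kbs : k * b <= s.
  have : K%:R * eps = k * b / s by rewrite epsE -kE; field; rewrite ?gt_eqF.
  by move=> e; move: Keps; rewrite e ler_pdivrMr// mul1r.
have hC' : C <= s * k.
  apply: le_trans hC _; rewrite -kE expr2 -mulrA mulrC; rewrite ler_pM2r//.
rewrite eKT; set L := ln T%:R in L4 hD *; set l := ln K%:R in lnK1 lnKh hD *.
have kb : k <= k * b by rewrite ler_peMr ?(ltW k0).
(* After division by [s], the corruption part of the rate is at least [8 * (k * b)], which absorbs
   [2 * k], [2 * (k * b)] and the additive constant. *)
have kbL : 4 * (k * b) <= L * (k * b) by rewrite ler_pM2r// mulr_gt0//; lra.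
case: ifP hD => _ hD.
- have -> : (2 * k * L + 2 * L * b) * (k * s) = s * (2 * k ^+ 2 * L + 2 * (L * (k * b))).
    by ring.
  have : 2 * k + D + (K%:R + 3) + 2 * (k * b) <= 2 * k ^+ 2 * L + 2 * (L * (k * b)).
    rewrite kE; nra.
  rewrite -(ler_pM2l s0); nra.
- have -> : (4 * k * l + 2 * L * b) * (k * s) = s * (4 * k ^+ 2 * l + 2 * (L * (k * b))).
    by ring.
  have : 2 * k + D + (K%:R + 3) + 2 * (k * b) <= 4 * k ^+ 2 * l + 2 * (L * (k * b)).
    rewrite kE; case: KE => [K3'|KE2].
      by have := K3 K3'; have := lnK1 K3'; nra.
    by rewrite KE2 in hD *; lra.
  rewrite -(ler_pM2l s0); nra.
Qed.

Lemma trivial_rate_bound (K T : nat) (beta alpha : R) :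
  (1 < K)%N -> (2 < T)%N -> 0 < beta -> ln T%:R <= 4 :> R ->
  T%:R <= if alpha < 3^-1 then
      (2 * Num.sqrt K%:R * ln T%:R + 2 * ln T%:R * T%:R `^ beta)
        * Num.sqrt (K%:R * T%:R)
    else
      (4 * Num.sqrt K%:R * ln K%:R + 2 * ln T%:R * T%:R `^ beta)
        * Num.sqrt (K%:R * T%:R).
Proof.
move=> K1 T2 b0 L4.
have T0 : (0 < T)%N by exact: leq_trans _ T2.
have t0 : (0 : R) < T%:R by rewrite ltr0n.
have lnKh : 2^-1 <= ln K%:R :> R by exact: ln_nat_ge_half.
have L1 : 1 <= ln T%:R :> R by exact: ln_nat_ge1.
have K2 : 2 <= K%:R :> R by rewrite ler_nat.
have s2 : ln T%:R <= 2 :> R -> Num.sqrt T%:R <= 3 :> R.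
  by move=> h; have := @sqrt_le_of_ln T%:R 1 t0; rewrite expr1 mulr1; apply.
have s4 : Num.sqrt T%:R <= 9 :> R.
  have := @sqrt_le_of_ln T%:R 2 t0; have -> : (3 ^+ 2 = 9 :> R) by ring.
  by apply; lra.
rewrite sqrtrM ?ler0n//.
have bge1 : 1 <= T%:R `^ beta :> R.
  by rewrite -[leLHS](powRr0 T%:R); apply: ler_powR; [rewrite ler1n|exact: ltW].
have kE : Num.sqrt K%:R ^+ 2 = K%:R :> R by rewrite sqr_sqrtr ?ler0n.
have sE : Num.sqrt T%:R ^+ 2 = T%:R :> R by rewrite sqr_sqrtr ?ler0n.
have k0 : 0 < Num.sqrt K%:R :> R by rewrite sqrtr_gt0 ltr0n (leq_trans _ K1).
have s0 : 0 < Num.sqrt T%:R :> R by rewrite sqrtr_gt0 ltr0n.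
rewrite -[leLHS]sE.
move: (Num.sqrt K%:R) (Num.sqrt T%:R) (T%:R `^ beta) kE sE k0 s0 bge1 s2 s4
  => k s b kE sE k0 s0 bge1 s2 s4.
have k1 : 7 / 5 <= k by rewrite -(ler_pXn2r (ltn0Sn 1)) ?nnegrE ?ltW//; lra.
set L := ln T%:R in L1 L4 s2 *; set l := ln K%:R in lnKh *.
have kb : 7 / 5 <= k * b by nra.
have kbL : 7 / 5 * L <= L * (k * b) by rewrite mulrC ler_pM2l//; lra.
(* The two right-hand sides bound the rate divided by [s] from below, in the second and first range
   of [alpha] respectively, through [K >= 2], [ln K >= 1 / 2] and [k * b >= 7 / 5]. On the left,
   [s <= 3] if [L <= 2] and [s <= 9] otherwise. *)
have sL : s <= 4 + 14 / 5 * L by case: (lerP L 2) => [/s2|]; lra.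
have sL' : s <= 34 / 5 * L by case: (lerP L 2) => [/s2|]; lra.
case: ifP => _.
- have -> : (2 * k * L + 2 * L * b) * (k * s) = s * (2 * k ^+ 2 * L + 2 * (L * (k * b))).
    by ring.
  rewrite expr2 ler_pM2l// kE; nra.
- have -> : (4 * k * l + 2 * L * b) * (k * s) = s * (4 * k ^+ 2 * l + 2 * (L * (k * b))).
    by ring.
  rewrite expr2 ler_pM2l// kE; nra.
Qed.

End Numerics.

(** * Regret analysis of the algorithm *)

Section RegularizedEXP3.
Set Implicit Arguments. Unset Strict Implicit.
Context {R : realType} {d : measure_display} {Omega : measurableType d}.
Variables (P : probability Omega R) (K T : nat) (alpha eta eps : R).
Variables (F G : nat -> set_system Omega).
Variables (ell ellc : nat -> 'I_K -> Omega -> R) (A : nat -> Omega -> 'I_K).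
Variables (x z : nat -> Omega -> 'I_K -> R).

Definition lhat t w i : R := if A t w == i then ellc t (A t w) w / x t w i else 0.
Definition ltil t w i : R := lhat t w i + eps * pderiv (reg_eps eps) (x t w) i.
Definition pick t i : Omega -> R := \1_[set w | A t w = i].
Definition corruption t w : R := \big[Num.max/0]_(a < K) `|ellc t a w - ell t a w|.

Hypotheses (K0 : (0 < K)%N) (alpha01 : 0 <= alpha <= 1) (eta0 : 0 < eta)
  (eps0 : 0 < eps).
Hypothesis sigmaFG : forall t, sigma_algebra setT (F t) /\ sigma_algebra setT (G t).
Hypothesis FGmeas : forall t, F t `<=` measurable /\ G t `<=` measurable.
Hypothesis FG : forall t, F t `<=` G t /\ G t `<=` F t.+1.
Hypothesis lossG : forall t a B, (t < T)%N -> measurable B ->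
  G t (ell t a @^-1` B) /\ G t (ellc t a @^-1` B).
Hypothesis armF : forall t j, (t < T)%N -> F t.+1 [set w | A t w = j].
Hypothesis loss01 : forall t a w, (t < T)%N ->
  0 <= ell t a w <= 1 /\ 0 <= ellc t a w <= 1.
Hypothesis z_init : forall w, z 0 w = (fun=> K%:R^-1).
Hypothesis x_proj : forall t w, (t < T)%N -> trunc_simplex eps (x t w) /\
  forall y, trunc_simplex eps y ->
    bregman (phi_alpha alpha) (x t w) (z t w) <= bregman (phi_alpha alpha) y (z t w).
Hypothesis arm_law : forall t j E, (t < T)%N -> G t E ->
  P (E `&` [set w | A t w = j]) = (\int[P]_(w in E) (x t w j)%:E)%E.
Hypothesis z_mirror : forall t w, (t < T)%N -> pos_orthant (z t.+1 w) /\
  forall y, pos_orthant y ->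
    eta * dotv (ltil t w) (z t.+1 w) + bregman (phi_alpha alpha) (z t.+1 w) (x t w)
    <= eta * dotv (ltil t w) y + bregman (phi_alpha alpha) y (x t w).

Lemma x01 t w i : (t < T)%N -> 0 < x t w i <= 1.
Proof. by move=> tT; apply: trunc_simplexP eps0 _; exact: (x_proj w tT).1. Qed.

Lemma x_gt0 t w i : (t < T)%N -> 0 < x t w i.
Proof. by move=> tT; have /andP[] := x01 w i tT. Qed.

Lemma z_gt0 t w i : (t <= T)%N -> 0 < z t w i.
Proof.
case: t => [_|t tT]; first by rewrite z_init invr_gt0 ltr0n.
exact: (z_mirror w tT).1.
Qed.

Lemma lhatE t w i : lhat t w i = pick t i w * (ellc t i w / x t w i).
Proof.
rewrite /lhat /pick indicE; case: eqP => [e|h].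
  by rewrite mem_set// mul1r e.
by rewrite memNset ?mul0r.
Qed.

Lemma ltilE t w i : (t < T)%N ->
  ltil t w i = pick t i w * (ellc t i w / x t w i) + (1 - eps / x t w i).
Proof.
move=> tT; rewrite /ltil lhatE pderiv_reg; last exact: x_gt0.
by rewrite mulrBr mulfV// lt0r_neq0.
Qed.

(** With weight [eps] the regularizer contributes [1 - eps / x t w i], which the floor [eps] of the
    simplex keeps nonnegative. This makes [ltil] nonnegative, as [mirror_step] requires. *)
Lemma reg_grad01 t w i : (t < T)%N -> 0 <= 1 - eps / x t w i <= 1.
Proof.
move=> tT; have x0 := x_gt0 w i tT.
rewrite subr_ge0 ler_pdivrMr// mul1r (x_proj w tT).1.1/= gerBl.
by rewrite divr_ge0 ?ltW.
Qed.

Lemma pick01 t i w : pick t i w = 0 \/ pick t i w = 1.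
Proof. by rewrite /pick indicE; case: (_ \in _); [right|left]. Qed.

Lemma sum_pick t w (h : 'I_K -> R) : \sum_(i < K) pick t i w * h i = h (A t w).
Proof.
rewrite (bigD1 (A t w))//= /pick indicE mem_set// mul1r big1 ?addr0//.
by move=> i /eqP/nesym iA; rewrite indicE memNset ?mul0r.
Qed.

Lemma ltil_ge0 t w i : (t < T)%N -> 0 <= ltil t w i.
Proof.
move=> tT; rewrite ltilE//; have /andP[r0 _] := reg_grad01 w i tT.
apply: addr_ge0 => //; apply: mulr_ge0.
  by case: (pick01 t i w) => ->.
by apply: divr_ge0; [have [_ /andP[]] := loss01 i w tT|rewrite ltW ?x_gt0].
Qed.

Lemma dpot_z t w i : (t < T)%N ->
  dpot alpha (z t.+1 w i) = dpot alpha (x t w i) - eta * ltil t w i.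
Proof.
move=> tT; apply: mirror_optimality => //.
- by move=> j; exact: x_gt0.
- by move=> j; exact: z_gt0.
exact: (z_mirror w tT).2.
Qed.

(** Telescoping: the projection does not increase the divergence to [u], and the mirror step pays
    for the linear loss of the round. *)
Lemma mirror_descent_regret u w n : trunc_simplex eps u -> (n <= T)%N ->
  eta * \sum_(t < n) \sum_(i < K) ltil t w i * (x t w i - u i) <=
  breg alpha u (z 0 w) - breg alpha u (z n w) +
  eta ^+ 2 * \sum_(t < n) \sum_(i < K) ltil t w i ^+ 2 * x t w i.
Proof.
move=> hu; elim: n => [_|n IH nT]; first by rewrite !big_ord0 !mulr0 subrr addr0.
have := IH (ltnW nT); rewrite !big_ord_recr/= !mulrDr.
have := @mirror_step R K alpha eta (ltil n w) (x n w) (z n.+1 w) u alpha01 (ltW eta0)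
  (fun i => ltil_ge0 w i nT) (fun i => x01 w i nT) (fun i => z_gt0 w i nT)
  (fun i => dpot_z w i nT).
have := @projection_step R K alpha eps (x n w) (z n w) u alpha01 eps0
  (fun i => z_gt0 w i (ltnW nT)) (x_proj w nT).1 (x_proj w nT).2 hu.
lra.
Qed.

(** Subtracting the vanishing sum of [x i - u i] removes the constant 1 from the regularizer's
    gradient. What remains, [- eps / x i * (x i - u i)], is at least [- eps] for each arm. *)
Lemma round_lower u t w : trunc_simplex eps u -> (t < T)%N ->
  ellc t (A t w) w - \sum_(i < K) pick t i w * (u i * ellc t i w / x t w i) - eps * K%:R
  <= \sum_(i < K) ltil t w i * (x t w i - u i).
Proof.
move=> hu tT; rewrite -(sum_pick t w (fun i => ellc t i w)).
have e1 : \sum_(i < K) (x t w i - u i) = 0.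
  by rewrite sumrB hu.2 (x_proj w tT).1.2 subrr.
rewrite -[leRHS]subr0 -[X in _ <= _ - X]e1.
have -> : eps * K%:R = \sum_(i < K) eps by rewrite sumr_const card_ord mulr_natr.
rewrite -!sumrB; apply: ler_sum => i _; rewrite ltilE//.
have x0 := x_gt0 w i tT.
have -> : (pick t i w * (ellc t i w / x t w i) + (1 - eps / x t w i)) *
    (x t w i - u i) - (x t w i - u i) =
  pick t i w * ellc t i w - pick t i w * (u i * ellc t i w / x t w i) - eps
  + eps * u i / x t w i.
  by field; exact: lt0r_neq0.
rewrite lerDl; apply: divr_ge0; last exact: ltW.
by apply: mulr_ge0; [exact: ltW|exact: le_trans (ltW eps0) (hu.1 i)].
Qed.

(** Expanding the square on the drawn arm gives at most [1 / x i + 2 + x i], and on any other arm at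
    most [x i]. The 3 collects the 2 of the drawn arm and the total mass 1 of [x]. *)
Lemma round_upper t w : (t < T)%N ->
  \sum_(i < K) ltil t w i ^+ 2 * x t w i <= \sum_(i < K) pick t i w * (x t w i)^-1 + 3.
Proof.
move=> tT.
have -> : 3 = \sum_(i < K) (pick t i w * 2 + x t w i) :> R.
  by rewrite big_split/= (x_proj w tT).1.2 sum_pick; ring.
rewrite -big_split/=; apply: ler_sum => i _; rewrite ltilE//.
have x0 := x_gt0 w i tT; have /andP[r0 r1] := reg_grad01 w i tT.
have /andP[c0 c1] := (loss01 i w tT).2.
set r := 1 - _ in r0 r1 *; set c := ellc t i w in c0 c1 *; set y := x t w i in x0 *.
have ry : r ^+ 2 * y <= y by rewrite ler_piMl ?(ltW x0)// exprn_ile1.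
case: (pick01 t i w) => ->; first by rewrite !mul0r !add0r.
rewrite !mul1r.
have -> : (c / y + r) ^+ 2 * y = c ^+ 2 / y + 2 * (c * r) + r ^+ 2 * y.
  by field; exact: lt0r_neq0.
have : c ^+ 2 / y <= y^-1.
  by rewrite ler_piMl ?invr_ge0 ?(ltW x0)// exprn_ile1.
have : c * r <= 1 by rewrite mulr_ile1.
lra.
Qed.

(** By induction on [t]. In round 0 all outcomes project the same point, so the Hölder bound makes
    [x] constant; later the dual vector [theta] is measurable by [dpot_z], and the projection is
    continuous in it. *)
Lemma x_sub_measurable t j : (t < T)%N -> sub_measurable (F t) (fun w => x t w j).
Proof.
elim: t j => [|t IH] j tT.
  have xc w w' : x 0 w j = x 0 w' j.
    have := @projection_continuous R K alpha eps (x 0 w) (x 0 w') (z 0 w) (z 0 w') j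
      alpha01 eps0 (fun i => z_gt0 w i (ltnW tT)) (fun i => z_gt0 w' i (ltnW tT))
      (x_proj w tT).1 (x_proj w' tT).1 (x_proj w tT).2 (x_proj w' tT).2.
    rewrite !z_init; under eq_bigr do rewrite subrr normr0.
    by rewrite sumr_const mul0rn => h; apply/eqP; rewrite -subr_eq0 -sqrf_eq0 eq_le h sqr_ge0.
  rewrite /sub_measurable.
  have -> : (fun w => x 0 w j) = cst (x 0 point j) by apply/funext => w; exact: xc.
  exact: measurable_cst.
have tT' := ltnW tT.
have [sF _] := sigmaFG t.+1.
have up f : sub_measurable (G t) f -> sub_measurable (F t.+1) f.
  move=> /(sub_measurableP (sigmaFG t).2) h.
  by apply/(sub_measurableP sF) => B mB; apply: (FG t).2; exact: h.
have mx i : sub_measurable (F t.+1) (fun w => x t w i).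
  apply: up; have /(sub_measurableP (sigmaFG t).1) h := IH i tT'.
  by apply/(sub_measurableP (sigmaFG t).2) => B mB; apply: (FG t).1; exact: h.
have mV i : sub_measurable (F t.+1) (fun w => (x t w i)^-1).
  rewrite /sub_measurable.
  have -> : (fun w => (x t w i)^-1) = (fun w => x t w i `^ (-1)).
    by apply/funext => w; rewrite powR_inv1// ltW// x_gt0.
  exact: (measurableT_comp (measurable_powR (-1)) (mx i)).
have ml i : sub_measurable (F t.+1) (fun w => ltil t w i).
  rewrite /sub_measurable; under eq_fun do rewrite ltilE//.
  apply: measurable_funD.
    apply: measurable_funM; first exact: (sub_measurable_indic sF (armF i tT')).
    apply: measurable_funM; last exact: mV.
    apply: up; apply/(sub_measurableP (sigmaFG t).2) => B mB.
    exact: (lossG i tT' mB).2.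
  by apply: measurable_funB => //; apply: measurable_funM => //; exact: mV.
pose theta i w := dpot alpha (z t.+1 w i).
have mtheta i : sub_measurable (F t.+1) (theta i).
  rewrite /sub_measurable.
  have -> : theta i = (fun w => dpot alpha (Num.max 0 (x t w i)) - eta * ltil t w i).
    apply/funext => w; rewrite /theta dpot_z//.
    by rewrite (_ : Num.max 0 _ = x t w i)//; apply/max_idPr; rewrite ltW ?x_gt0.
  apply: measurable_funB; last by apply: measurable_funM => //; exact: ml.
  exact: (measurableT_comp (measurable_dpot alpha) (mx i)).
apply: (@measurable_fun_of_continuous_coords R _ (g_sigma_algebraType (F t.+1)) K theta) => // w e e0.
(* The Hölder bound controls the squared deviation by the sum of [K] dual gaps, which must stay
   below [e ^ 2]. *)
exists (e ^+ 2 / K%:R); first by rewrite divr_gt0 ?exprn_gt0 ?ltr0n.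
move=> w' h.
have := @projection_continuous R K alpha eps (x t.+1 w) (x t.+1 w') (z t.+1 w) (z t.+1 w') j
  alpha01 eps0 (fun i => z_gt0 w i (ltnW tT)) (fun i => z_gt0 w' i (ltnW tT))
  (x_proj w tT).1 (x_proj w' tT).1 (x_proj w tT).2 (x_proj w' tT).2.
have : \sum_(i < K) `|theta i w - theta i w'| < e ^+ 2.
  have -> : e ^+ 2 = \sum_(i < K) (e ^+ 2 / K%:R).
    by rewrite sumr_const card_ord -(mulr_natr (_ / _)) divfK// pnatr_eq0 -lt0n.
  by apply: ltr_sum => //; apply/hasP; exists (Ordinal K0) => //; rewrite mem_index_enum.
move=> /[swap] /le_lt_trans /[apply] hlt.
rewrite ltNge; apply/negP => hge; move: hlt; rewrite ltNge => /negP; apply.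
rewrite -[leRHS]sqrrN ler_pXn2r ?nnegrE ?(ltW e0)//; lra.
Qed.

Lemma pick_bounded t i : (t < T)%N -> bounded_measurable (pick t i).
Proof.
by move=> tT; apply: bounded_measurable_indic; apply: (FGmeas t.+1).1; exact: armF.
Qed.

Lemma x_sub_measurableG t j : (t < T)%N -> sub_measurable (G t) (fun w => x t w j).
Proof.
move=> tT; have /(sub_measurableP (sigmaFG t).1) h := x_sub_measurable j tT.
by apply/(sub_measurableP (sigmaFG t).2) => B mB; apply: (FG t).1; exact: h.
Qed.

Lemma xV_sub_measurableG t j : (t < T)%N ->
  sub_measurable (G t) (fun w => (x t w j)^-1).
Proof.
move=> tT; rewrite /sub_measurable.
have -> : (fun w => (x t w j)^-1) = (fun w => x t w j `^ (-1)).
  by apply/funext => w; rewrite powR_inv1// ltW// x_gt0.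
exact: (measurableT_comp (measurable_powR (-1)) (x_sub_measurableG j tT)).
Qed.

Lemma x_bounded t j : (t < T)%N -> bounded_measurable (fun w => x t w j).
Proof.
move=> tT; apply: bounded_measurable01.
  exact: sub_measurable_measurable (sigmaFG t).2 (FGmeas t).2 _ (x_sub_measurableG j tT).
by move=> w; have /andP[/ltW -> ->] := x01 w j tT.
Qed.

Lemma xV_bounded t j : (t < T)%N -> bounded_measurable (fun w => (x t w j)^-1).
Proof.
move=> tT; split.
  exact: sub_measurable_measurable (sigmaFG t).2 (FGmeas t).2 _ (xV_sub_measurableG j tT).
exists eps^-1 => w; have x0 := x_gt0 w j tT.
by rewrite ger0_norm ?invr_ge0 ?(ltW x0)// lef_pV2 ?posrE// (x_proj w tT).1.1.
Qed.

Lemma ellc_sub_measurableG t j : (t < T)%N -> sub_measurable (G t) (ellc t j).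
Proof.
move=> tT; apply/(sub_measurableP (sigmaFG t).2) => B mB.
exact: (lossG j tT mB).2.
Qed.

Lemma ellc_bounded t j : (t < T)%N -> bounded_measurable (ellc t j).
Proof.
move=> tT; apply: bounded_measurable01.
  exact: sub_measurable_measurable (sigmaFG t).2 (FGmeas t).2 _ (ellc_sub_measurableG j tT).
by move=> w; exact: (loss01 j w tT).2.
Qed.

Lemma ell_bounded t j : (t < T)%N -> bounded_measurable (ell t j).
Proof.
move=> tT; apply: bounded_measurable01.
  apply: (sub_measurable_measurable (sigmaFG t).2 (FGmeas t).2).
  by apply/(sub_measurableP (sigmaFG t).2) => B mB; exact: (lossG j tT mB).1.
by move=> w; exact: (loss01 j w tT).1.
Qed.

Lemma selected_bounded (h : 'I_K -> Omega -> R) t : (t < T)%N ->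
  (forall i, bounded_measurable (h i)) -> bounded_measurable (fun w => h (A t w) w).
Proof.
move=> tT bh; under eq_fun do rewrite -(sum_pick t _ (fun i => h i _)).
apply: bounded_measurable_sum => i; apply: bounded_measurableM => //.
exact: pick_bounded.
Qed.

(** The arm is drawn given [G t], which contains the losses of round [t]; hence [f] may depend on
    them as well as on the past. *)
Lemma Ex_pick t i f : (t < T)%N -> sub_measurable (G t) f -> bounded_measurable f ->
  Ex P (fun w => pick t i w * f w) = Ex P (fun w => x t w i * f w).
Proof.
move=> tT mf bf; apply: (@Ex_conditional _ _ _ P (G t)) => //.
- exact: (sigmaFG t).2.
- exact: (FGmeas t).2.
- by apply: (FGmeas t.+1).1; exact: armF.
- exact: x_bounded.
- by move=> w; have /andP[/ltW -> ->] := x01 w i tT.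
by move=> E GE; exact: arm_law.
Qed.

(** Unbiasedness of the importance-weighted estimate. *)
Lemma Ex_pick_loss (c : R) t i : (t < T)%N ->
  Ex P (fun w => pick t i w * (c * ellc t i w / x t w i)) = c * Ex P (ellc t i).
Proof.
move=> tT; rewrite Ex_pick//.
- rewrite -ExZ; last exact: ellc_bounded.
  by congr (Ex P _); apply/funext => w; field; rewrite gt_eqF ?x_gt0.
- apply: measurable_funM; last exact: xV_sub_measurableG.
  by apply: measurable_funM => //; exact: ellc_sub_measurableG.
- apply: bounded_measurableM; last exact: xV_bounded.
  by apply: bounded_measurableM; [exact: bounded_measurable_cst|exact: ellc_bounded].
Qed.

Lemma Ex_pick_inv t i : (t < T)%N -> Ex P (fun w => pick t i w * (x t w i)^-1) = 1.
Proof.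
move=> tT; rewrite Ex_pick//; [|exact: xV_sub_measurableG|exact: xV_bounded].
rewrite -[RHS](Ex_cst P 1); congr (Ex P _); apply/funext => w.
by rewrite mulfV// gt_eqF ?x_gt0.
Qed.

Lemma observed_regret u : trunc_simplex eps u ->
  \sum_(t < T) (Ex P (fun w => ellc t (A t w) w) - \sum_(i < K) u i * Ex P (ellc t i))
  <= eta^-1 * breg alpha u (fun=> K%:R^-1) + eta * T%:R * (K%:R + 3)
     + eps * K%:R * T%:R.
Proof.
move=> hu.
pose lo t w := ellc t (A t w) w -
  \sum_(i < K) pick t i w * (u i * ellc t i w / x t w i) - eps * K%:R.
pose hi t w := \sum_(i < K) pick t i w * (x t w i)^-1 + 3.
(* The bound holds outcome by outcome; the final divergence from [z T w] is nonnegative and is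
   dropped. *)
have path w : \sum_(t < T) lo t w <=
    eta^-1 * breg alpha u (fun=> K%:R^-1) + eta * \sum_(t < T) hi t w.
  have := mirror_descent_regret w hu (leqnn T); rewrite z_init.
  have := @breg_ge0 R K alpha u (z T w) alpha01
    (fun i => (andP (trunc_simplexP i eps0 hu)).1) (fun i => z_gt0 w i (leqnn T)).
  have h1 : \sum_(t < T) lo t w <= \sum_(t < T) \sum_(i < K) ltil t w i * (x t w i - u i).
    by apply: ler_sum => t _; exact: round_lower.
  have h2 : \sum_(t < T) \sum_(i < K) ltil t w i ^+ 2 * x t w i <= \sum_(t < T) hi t w.
    by apply: ler_sum => t _; exact: round_upper.
  move=> b0 h; rewrite -(ler_pM2l eta0) mulrDr mulrA mulfV ?gt_eqF// mul1r mulrA -expr2.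
  rewrite -(ler_pM2l eta0) in h1; rewrite -(ler_pM2l (exprn_gt0 2 eta0)) in h2.
  lra.
have bpl (t : 'I_T) i : bounded_measurable (fun w => pick t i w * (u i * ellc t i w / x t w i)).
  apply: bounded_measurableM; first exact: pick_bounded.
  apply: bounded_measurableM; last exact: xV_bounded.
  by apply: bounded_measurableM; [exact: bounded_measurable_cst|exact: ellc_bounded].
have bpi (t : 'I_T) i : bounded_measurable (fun w => pick t i w * (x t w i)^-1).
  by apply: bounded_measurableM; [exact: pick_bounded|exact: xV_bounded].
have bsel (t : 'I_T) : bounded_measurable (fun w => ellc t (A t w) w).
  by apply: selected_bounded => // i; exact: ellc_bounded.
have bsum (t : 'I_T) := bounded_measurable_sum (bpl t).
have bsumi (t : 'I_T) := bounded_measurable_sum (bpi t).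
have bcst := @bounded_measurable_cst R d Omega.
have blo (t : 'I_T) : bounded_measurable (lo t).
  by do 2 apply: bounded_measurableB => //.
have bhi (t : 'I_T) : bounded_measurable (hi t) by exact: bounded_measurableD.
have Elo (t : 'I_T) : Ex P (lo t) = Ex P (fun w => ellc t (A t w) w) -
    \sum_(i < K) u i * Ex P (ellc t i) - eps * K%:R.
  rewrite /lo ExB//; last exact: bounded_measurableB.
  rewrite Ex_cst ExB// Ex_sum//; congr (_ - _ - _); apply: eq_bigr => i _.
  exact: Ex_pick_loss.
have Ehi (t : 'I_T) : Ex P (hi t) = K%:R + 3.
  rewrite /hi ExD// Ex_cst Ex_sum//; congr (_ + _).
  by under eq_bigr do rewrite Ex_pick_inv//; rewrite sumr_const card_ord.
have bshi := bounded_measurable_sum bhi.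
have := Ex_le P (bounded_measurable_sum blo) _ path.
rewrite ExD//; last exact: bounded_measurableM.
rewrite Ex_cst ExZ// !Ex_sum//.
under eq_bigr do rewrite Elo; rewrite sumrB.
under [X in eta * X]eq_bigr do rewrite Ehi.
rewrite !sumr_const !card_ord -(mulr_natr (eps * _)) -(mulr_natr (_ + 3)) => h.
have := h (bounded_measurableD (bcst _) (bounded_measurableM (bcst eta) bshi)).
by rewrite lerBlDr -!mulrA [(_ + 3) * _]mulrC.
Qed.

Lemma corruption_bounded t : (t < T)%N -> bounded_measurable (corruption t).
Proof.
move=> tT; apply: bounded_measurable01.
  rewrite /corruption; elim: (index_enum _) => [|a s IH].
    by under eq_fun do rewrite big_nil; exact: measurable_cst.
  under eq_fun do rewrite big_cons; apply: measurable_maxr => //.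
  apply: measurableT_comp => //.
  by apply: measurable_funB; [exact: (ellc_bounded a tT).1|exact: (ell_bounded a tT).1].
move=> w; apply/andP; split; first exact: bigmax_ge_id.
apply: bigmax_le => // a _.
by have [/andP[? ?] /andP[? ?]] := loss01 a w tT; rewrite ler_norml; lra.
Qed.

Lemma le_corruption t a w : `|ellc t a w - ell t a w| <= corruption t w.
Proof. exact: (le_bigmax _ (fun a => `|ellc t a w - ell t a w|)). Qed.

Lemma regret_le (a : 'I_K) u :
  u = (fun i => (1 - K%:R * eps) * (i == a)%:R + eps) -> trunc_simplex eps u ->
  \sum_(t < T) (Ex P (fun w => ell t (A t w) w) - Ex P (ell t a)) <=
  2 * \sum_(t < T) Ex P (corruption t)
  + eta^-1 * breg alpha u (fun=> K%:R^-1) + eta * T%:R * (K%:R + 3)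
  + 2 * (eps * K%:R * T%:R).
Proof.
move=> uE hu; have := observed_regret hu.
have bC (t : 'I_T) : bounded_measurable (corruption t) by exact: corruption_bounded.
have Ec (t : 'I_T) i : 0 <= Ex P (ellc t i) <= 1.
  have bc := ellc_bounded i (ltn_ord t).
  apply/andP; split.
    rewrite -(Ex_cst P 0); apply: Ex_le => //; first exact: bounded_measurable_cst.
    by move=> w; have [_ /andP[]] := loss01 i w (ltn_ord t).
  rewrite -[leRHS](Ex_cst P 1); apply: Ex_le => //; first exact: bounded_measurable_cst.
  by move=> w; have [_ /andP[]] := loss01 i w (ltn_ord t).
(* The corruption is paid twice, once for the arm played and once for arm [a]; [eps * K] is the
   price of the smoothed comparator. *)
have h (t : 'I_T) : Ex P (fun w => ell t (A t w) w) - Ex P (ell t a) <=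
    (Ex P (fun w => ellc t (A t w) w) - \sum_(i < K) u i * Ex P (ellc t i)) +
    (2 * Ex P (corruption t) + eps * K%:R).
  have tT := ltn_ord t.
  have h1 : Ex P (fun w => ell t (A t w) w) <=
      Ex P (fun w => ellc t (A t w) w) + Ex P (corruption t).
    have bs : bounded_measurable (fun w => ellc t (A t w) w).
      by apply: selected_bounded => // i; exact: ellc_bounded.
    rewrite -ExD//; apply: Ex_le => //; last first.
    - by move=> w; have := le_corruption t (A t w) w; rewrite ler_norml => /andP[]; lra.
    - exact: bounded_measurableD.
    - by apply: selected_bounded => // i; exact: ell_bounded.
  have h2 : Ex P (ellc t a) <= Ex P (ell t a) + Ex P (corruption t).
    have be := ell_bounded a tT.
    rewrite -ExD//; apply: Ex_le => //; last first.
    - by move=> w; have := le_corruption t a w; rewrite ler_norml => /andP[]; lra.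
    - exact: bounded_measurableD.
    - exact: ellc_bounded.
  have h3 : \sum_(i < K) u i * Ex P (ellc t i) <= Ex P (ellc t a) + eps * K%:R.
    rewrite uE; under eq_bigr do rewrite mulrDl.
    rewrite big_split/=; apply: lerD.
      rewrite (bigD1 a)//= eqxx mulr1 big1 ?addr0; last first.
        by move=> i /negbTE ->; rewrite mulr0 mul0r.
      have /andP[e0 e1] := Ec t a.
      by rewrite ler_piMl// gerBl mulr_ge0// ltW.
    have -> : eps * K%:R = \sum_(i < K) eps by rewrite sumr_const card_ord mulr_natr.
    apply: ler_sum => i _; have /andP[e0 e1] := Ec t i.
    by rewrite ler_piMr// ltW.
  lra.
move=> hobs; apply: le_trans (ler_sum _ (fun t _ => h t)) _.
rewrite big_split/= [X in _ + X]big_split/= -mulr_sumr.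
rewrite [X in _ + (_ + X)]sumr_const card_ord -(mulr_natr (eps * _)); lra.
Qed.

End RegularizedEXP3.

(** * The comparator and its divergence from the start *)

Section Comparator.
Set Implicit Arguments. Unset Strict Implicit.
Context {R : realType} {K : nat}.

Lemma trunc_simplex_size (eps : R) (y : 'I_K -> R) :
  trunc_simplex eps y -> K%:R * eps <= 1.
Proof.
move=> [ye y1]; rewrite -[leRHS]y1 mulr_natl -[X in _ *+ X](card_ord K) -sumr_const.
by apply: ler_sum => i _.
Qed.

Lemma smoothed_vertex_simplex (eps : R) (a : 'I_K) : K%:R * eps <= 1 ->
  trunc_simplex eps (fun i => (1 - K%:R * eps) * (i == a)%:R + eps).
Proof.
move=> h; split=> [j|]; first by rewrite lerDr mulr_ge0// subr_ge0.
rewrite big_split/= -mulr_sumr sumr_const card_ord (bigD1 a)//= eqxx big1 ?addr0.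
  by rewrite mulr1 -(mulr_natl eps) subrK.
by move=> i /negbTE ->.
Qed.

(** For small [alpha] the logarithmic bound applies with [1 / (K * eps) <= \sqrt T]; the resulting
    factor 1/2 offsets [1 / (1 - alpha) <= 2]. Otherwise the entropy bound at [1 / K] gives
    [3 * ln K]. *)
Lemma breg_uniform_rate (T : nat) (beta alpha eps : R) (u : 'I_K -> R) :
  (0 < K)%N -> (0 < T)%N -> 0 <= alpha <= 1 -> 0 < beta ->
  eps = T%:R `^ beta / (Num.sqrt K%:R * Num.sqrt T%:R) -> K%:R * eps <= 1 ->
  trunc_simplex eps u ->
  breg alpha u (fun=> K%:R^-1) <=
  if alpha < 3^-1 then K%:R * ln T%:R else 3 * K%:R * ln K%:R.
Proof.
move=> K0 T0 /andP[a0 a1] b0 epsE Keps hu.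
have k0 : (0 : R) < K%:R by rewrite ltr0n.
have t0 : (0 : R) < T%:R by rewrite ltr0n.
have K1 : (K%:R^-1 : R) <= 1 by rewrite invf_le1// ler1n.
have sk0 : 0 < Num.sqrt K%:R :> R by rewrite sqrtr_gt0.
have st0 : 0 < Num.sqrt T%:R :> R by rewrite sqrtr_gt0.
have p0 : 0 < T%:R `^ beta :> R by rewrite powR_gt0.
have e0 : 0 < eps by rewrite epsE divr_gt0// mulr_gt0.
have eK : eps <= K%:R^-1 by rewrite -[leRHS]mul1r ler_pdivlMr// mulrC.
case: ifP => ha3; last first.
  rewrite [3 * _]mulrC -mulrA.
  apply: (@breg_uniform_le R K alpha eps (- alpha^-1) _ u K0 hu) => i.
  have := @pot_sub_le_entropy R alpha K%:R^-1 (u i).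
  rewrite a1 andbT leNgt ha3 (trunc_simplexP i e0 hu) invr_gt0 k0 K1 => /(_ isT isT isT).
  by rewrite lnV ?posrE//; lra.
have a_lt1 : alpha < 1 by apply: lt_trans ha3 _; lra.
apply: (@le_trans _ _ (K%:R * ((1 - alpha)^-1 * ln (K%:R^-1 / eps)))).
  apply: (@breg_uniform_le R K alpha eps (1 - alpha)^-1 _ u K0 hu) => i.
  by apply: pot_sub_le_ln; rewrite ?a0 ?a_lt1 ?eK ?K1//; exact: hu.1.
rewrite ler_pM2l//.
have r1 : 1 <= K%:R^-1 / eps by rewrite ler_pdivlMr// mul1r.
have l0 := ln_ge0 r1.
have rs : K%:R^-1 / eps <= Num.sqrt T%:R.
  rewrite epsE -[X in X^-1](@sqr_sqrtr R K%:R) ?ler0n//.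
  set k := Num.sqrt K%:R in sk0 *; set s := Num.sqrt T%:R in st0 *.
  have -> : (k ^+ 2)^-1 / (T%:R `^ beta / (k * s)) = s / (k * T%:R `^ beta).
    by field; rewrite ?gt_eqF.
  rewrite ler_pdivrMr ?mulr_gt0// ler_peMr ?(ltW st0)//.
  have k1 : 1 <= k by rewrite -[leLHS]sqrtr1 ler_wsqrtr// ler1n.
  have b1 : 1 <= T%:R `^ beta :> R.
    by rewrite -[leLHS](powRr0 T%:R); apply: ler_powR; [rewrite ler1n|exact: ltW].
  nra.
have ls : ln (K%:R^-1 / eps) <= 2^-1 * ln T%:R.
  rewrite -ln_powR powR12_sqrt ?ler0n// ler_ln ?posrE//.
  exact: lt_le_trans r1.
have c2 : (1 - alpha)^-1 <= 2 by rewrite -[2]invrK lef_pV2 ?posrE; lra.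
apply: (@le_trans _ _ (2 * ln (K%:R^-1 / eps))); first by rewrite ler_wpM2r.
lra.
Qed.

End Comparator.

(** Feasibility reads [\sqrt K * T ^ beta <= \sqrt T]. It first gives [K <= T], so [T > 1] and
    [T ^ beta > 1]; read again, it gives [K < T]. *)
Lemma horizon_gt2 (R : realType) (K T : nat) (beta eps : R) :
  (1 < K)%N -> (0 < T)%N -> 0 < beta ->
  eps = T%:R `^ beta / (Num.sqrt K%:R * Num.sqrt T%:R) ->
  K%:R * eps <= 1 -> (2 < T)%N.
Proof.
move=> K1 T0 b0 epsE Keps; suff : (K < T)%N by exact: leq_ltn_trans.
have k0 : (0 : R) < K%:R by rewrite ltr0n (leq_trans _ K1).
have t0 : (0 : R) < T%:R by rewrite ltr0n.
have sk0 : 0 < Num.sqrt K%:R :> R by rewrite sqrtr_gt0.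
have st0 : 0 < Num.sqrt T%:R :> R by rewrite sqrtr_gt0.
have h : Num.sqrt K%:R * T%:R `^ beta <= Num.sqrt T%:R.
  move: Keps; rewrite epsE -[X in X * _](@sqr_sqrtr R K%:R) ?ler0n//.
  set k := Num.sqrt K%:R in sk0 *; set s := Num.sqrt T%:R in st0 *.
  have -> : k ^+ 2 * (T%:R `^ beta / (k * s)) = k * T%:R `^ beta / s.
    by field; rewrite ?gt_eqF.
  by rewrite ler_pdivrMr// mul1r.
have b1 : 1 <= T%:R `^ beta :> R.
  by rewrite -[leLHS](powRr0 T%:R); apply: ler_powR; [rewrite ler1n|exact: ltW].
have KT : (K <= T)%N.
  rewrite -(ler_nat R) -(ler_sqrt _ (ltW t0)).
  by apply: le_trans h; rewrite ler_peMr ?(ltW sk0).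
have b_gt1 : 1 < T%:R `^ beta :> R.
  rewrite /powR gt_eqF// expR_gt1 mulr_gt0// ln_gt0// ltr1n.
  exact: leq_trans K1 KT.
rewrite -(ltr_nat R) -(ltr_sqrt _ t0).
by apply: lt_le_trans h; rewrite ltr_pMr.
Qed.

Theorem theorem4
  (R : realType) (K T : nat) (beta alpha : R)
  (d : measure_display) (Omega : measurableType d) (P : probability Omega R)
  (Pa : 'I_K -> probability R R)
  (F G : nat -> set_system Omega)
  (ell ellc : nat -> 'I_K -> Omega -> R)
  (A : nat -> Omega -> 'I_K)
  (x z : nat -> Omega -> 'I_K -> R) :
  (0 < K)%N -> (0 < T)%N ->
  0 < beta < 2^-1 -> 0 <= alpha <= 1 ->
  let eta : R := (Num.sqrt (T%:R))^-1 in
  let eps : R := (Num.sqrt (K%:R))^-1 * T%:R `^ (- (2^-1 - beta)) in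
  let lam : R := eps in
  let phi := phi_alpha alpha in
  (* filtrations: F t = information before round t, G t = F t + (ell_t, ellc_t) *)
  (forall t, sigma_algebra setT (F t) /\ sigma_algebra setT (G t)) ->
  (forall t, F t `<=` measurable /\ G t `<=` measurable) ->
  (forall t, F t `<=` G t /\ G t `<=` F t.+1) ->
  (forall t a B, (t < T)%N -> measurable B ->
      G t (ell t a @^-1` B) /\ G t (ellc t a @^-1` B)) ->
  (forall t j, (t < T)%N -> F t.+1 [set w | A t w = j]) ->
  (* losses and corrupted losses lie in [0,1] *)
  (forall t a w, (t < T)%N ->
      0 <= ell t a w <= 1 /\ 0 <= ellc t a w <= 1) ->
  (* ell_t is independent of the past F t *)
  (forall t E (B : 'I_K -> set R), (t < T)%N -> F t E ->
      (forall a, measurable (B a)) ->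
      P (E `&` [set w | forall a, B a (ell t a w)]) =
      (P E * P [set w | forall a, B a (ell t a w)])%E) ->
  (* ell_{t,a} has law Pa a *)
  (forall t a B, (t < T)%N -> measurable B -> P (ell t a @^-1` B) = Pa a B) ->
  (* corruption budget *)
  (\sum_(t < T) \int[P]_w
      (\big[Num.max/0]_(a < K) `|ellc t a w - ell t a w|)%:E
     <= (K%:R * T%:R `^ beta)%:E)%E ->
  (* Regularized-EXP3 *)
  (forall w, z 0 w = (fun _ => K%:R^-1)) ->
  (forall t w, (t < T)%N ->
      trunc_simplex eps (x t w) /\
      forall y, trunc_simplex eps y ->
        bregman phi (x t w) (z t w) <= bregman phi y (z t w)) ->
  (forall t j E, (t < T)%N -> G t E ->
      (P (E `&` [set w | A t w = j]) = \int[P]_(w in E) (x t w j)%:E)%E) ->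
  (let lhat t w i :=
     if A t w == i then ellc t (A t w) w / x t w i else 0 in
   let ltil t w i := lhat t w i + lam * pderiv (reg_eps eps) (x t w) i in
   forall t w, (t < T)%N ->
     pos_orthant (z t.+1 w) /\
     forall y, pos_orthant y ->
       eta * dotv (ltil t w) (z t.+1 w) + bregman phi (z t.+1 w) (x t w)
       <= eta * dotv (ltil t w) y + bregman phi y (x t w)) ->
  let mu a := (\int[Pa a]_r r%:E)%E in
  let mustar := \big[Order.min/+oo%E]_(a < K) mu a in
  let regret := (\int[P]_w (\sum_(t < T) ell t (A t w) w)%:E
                 - (T%:R)%:E * mustar)%E in
  let bound : R :=
    if alpha < 3^-1 then
      (2 * Num.sqrt K%:R * ln T%:R + 2 * ln T%:R * T%:R `^ beta)
        * Num.sqrt (K%:R * T%:R)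
    else
      (4 * Num.sqrt K%:R * ln K%:R + 2 * ln T%:R * T%:R `^ beta)
        * Num.sqrt (K%:R * T%:R) in
  (regret <= bound%:E)%E.
Proof.
move=> K0 T0 /andP[b0 b2] ha eta eps lam phi sFG mFG FG lossG armF loss01 _ law
  budget zinit xproj armlaw zmirror; lazy zeta.
pose mu a := (\int[Pa a]_r r%:E)%E; set mustar := \big[_/_]_(a < K) _.
set regret := (_ - _)%E; set bound : R := if _ then _ else _.
have t0 : (0 : R) < T%:R by rewrite ltr0n.
have st0 : 0 < Num.sqrt T%:R :> R by rewrite sqrtr_gt0.
have epsE := @truncation_levelE R K T beta K0 T0; rewrite -/eps in epsE.
have eta0 : 0 < eta by rewrite invr_gt0.
have eps0 : 0 < eps by rewrite mulr_gt0 ?invr_gt0 ?powR_gt0// sqrtr_gt0 ltr0n.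
(* The iterate of round 0, which exists because [T > 0], witnesses feasibility. *)
have Keps := trunc_simplex_size (xproj 0 point T0).1.
have bell (t : 'I_T) a : bounded_measurable (ell t a).
  exact: (ell_bounded sFG mFG lossG loss01).
have bsel (t : 'I_T) : bounded_measurable (fun w => ell t (A t w) w).
  by apply: (selected_bounded mFG armF).
have muE (t : 'I_T) a : mu a = (Ex P (ell t a))%:E.
  by apply: Ex_pushforward => // B mB; exact: law.
(* As there is at least one arm, the minimum is attained and the default [+oo] does not matter. *)
have [a _ mustarE] : {a | a \in xpredT & mustar = mu a}.
  by apply: (eq_bigmin (Ordinal K0)) => // i _; exact: leey.
have regretE : regret = (\sum_(t < T) (Ex P (fun w => ell t (A t w) w) - Ex P (ell t a)))%:E.
  rewrite /regret mustarE (muE (Ordinal T0)) EFin_Ex; last exact: bounded_measurable_sum.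
  rewrite Ex_sum// -EFinM -EFinB sumrB; congr (_ - _)%:E.
  (* The law of an arm's loss is the same in all rounds, so round 0 serves as representative. *)
  have e (t : 'I_T) : Ex P (ell t a) = Ex P (ell (Ordinal T0) a).
    by apply: EFin_inj; rewrite -!muE.
  by under eq_bigr do rewrite e; rewrite sumr_const card_ord mulr_natl.
rewrite regretE lee_fin.
have lnT0 : 0 <= ln T%:R :> R by rewrite ln_ge0// ler1n.
have lnK0 : 0 <= ln K%:R :> R by rewrite ln_ge0// ler1n.
(* With a single arm the learner always plays the best one: the regret is 0 and the rate is
   nonnegative. *)
have [K1|K1] := ltnP 1 K; last first.
  rewrite big1 => [|t _].
    rewrite /bound; case: ifP => _.
      by rewrite mulr_ge0 ?addr_ge0 ?mulr_ge0 ?sqrtr_ge0 ?powR_ge0.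
    by rewrite mulr_ge0 ?addr_ge0 ?mulr_ge0 ?sqrtr_ge0 ?powR_ge0.
  apply/eqP; rewrite subr_eq0; apply/eqP; congr (Ex P _); apply/funext => w.
  congr (ell t _ w); apply: val_inj => /=.
  have lt1 (i : 'I_K) : nat_of_ord i = 0%N.
    by apply/eqP; rewrite -leqn0 -ltnS; exact: leq_trans (ltn_ord i) K1.
  by rewrite !lt1.
have T2 := horizon_gt2 K1 T0 b0 epsE Keps.
have [L4|L4] := lerP 4 (ln T%:R : R); last first.
  apply: le_trans (trivial_rate_bound alpha K1 T2 b0 (ltW L4)).
  have -> : T%:R = \sum_(t < T) 1 :> R by rewrite sumr_const card_ord.
  apply: ler_sum => t _.
  have h1 : Ex P (fun w => ell t (A t w) w) <= 1.
    rewrite -[leRHS](Ex_cst P 1); apply: Ex_le => //; first exact: bounded_measurable_cst.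
    by move=> w; have [/andP[]] := loss01 t (A t w) w (ltn_ord t).
  have h2 : 0 <= Ex P (ell t a).
    rewrite -(Ex_cst P 0); apply: Ex_le => //; first exact: bounded_measurable_cst.
    by move=> w; have [/andP[]] := loss01 t a w (ltn_ord t).
  lra.
have hu := smoothed_vertex_simplex a Keps.
apply: le_trans (regret_le K0 ha eta0 eps0 sFG mFG FG lossG armF loss01 zinit xproj
  armlaw zmirror erefl hu) _.
have bcor (t : 'I_T) : bounded_measurable (corruption ell ellc t).
  exact: (corruption_bounded sFG mFG lossG loss01).
have hC : \sum_(t < T) Ex P (corruption ell ellc t) <= K%:R * T%:R `^ beta.
  rewrite -lee_fin; apply: le_trans budget; rewrite -sumEFin.
  by apply: lee_sum => t _; rewrite -EFin_Ex.
have := rate_bound K1 b0 L4 T0 epsE Keps hC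
  (breg_uniform_rate K0 T0 ha b0 epsE Keps hu).
rewrite -/bound; apply: le_trans.
have -> : eta^-1 = Num.sqrt T%:R by rewrite invrK.
have -> : eta * T%:R = Num.sqrt T%:R.
  by rewrite -[X in _ * X](@sqr_sqrtr R T%:R) ?ler0n// expr2 mulKf// gt_eqF.
by [].
Qed.
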